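(* Let $A^2_\nu$ be a Zen space, with associated weight $w(t)=2\pi\int_0^\infty e^{-2rt}\,d\tilde\nu(r)$, for which the Laplace transform $\mathfrak{L}:L^2_w(0,\infty)\to A^2_\nu$ is surjective. Then there is no compact composition operator on $A^2_\nu$; that is, there is no holomorphic map $\varphi:\mathbb{C}_+\to\mathbb{C}_+$ for which $C_\varphi F:=F\circ\varphi$ defines a compact operator $A^2_\nu\to A^2_\nu$.
   Context: $\mathbb{C}_+=\{z\in\mathbb{C}:\operatorname{Re}(z)>0\}$ and $\overline{\mathbb{C}_+}=[0,\infty)\times i\mathbb{R}$. Zen spaces: let $\tilde\nu$ be a positive regular Borel measure on $[0,\infty)$ with $0<\tilde\nu[0,r)<\infty$ for all $r>0$, satisfying $\sup_{r>0}\tilde\nu[0,2r)/\tilde\nu[0,r)<\infty$. Let $\nu$ be the product of $\tilde\nu$ with Lebesgue measure on $i\mathbb{R}$, a measure on $\overline{\mathbb{C}_+}$. The Zen space $A^2_\nu$ is the space of analytic $F:\mathbb{C}_+\to\mathbb{C}$ with $\|F\|^2_{A^2_\nu}:=\sup_{\varepsilon>0}\int_{\overline{\mathbb{C}_+}}|F(z+\varepsilon)|^2\,d\nu(z)<\infty$. $L^2_w(0,\infty)$ is the space of measurable $f:(0,\infty)\to\mathbb{C}$ with $\|f\|^2=\int_0^\infty|f(t)|^2w(t)\,dt<\infty$. It is known that the Laplace transform $\mathfrak{L}f(z)=\int_0^\infty e^{-tz}f(t)\,dt$ is an isometry from $L^2_w(0,\infty)$ into $A^2_\nu$. *)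

(* Defs.v *)
From HB Require Import structures.
From mathcomp Require Import all_boot all_order all_algebra.
From mathcomp Require Import complex.
From mathcomp Require Import all_classical all_reals all_analysis.

Set Implicit Arguments.
Unset Strict Implicit.
Unset Printing Implicit Defensive.

Import Order.TTheory GRing.Theory Num.Theory.
Import numFieldNormedType.Exports.

Local Open Scope classical_set_scope.
Local Open Scope complex_scope.
Local Open Scope ring_scope.

Section Complex.
Variable R : realType.

Definition right_half_plane : set R[i] := [set z | 0 < complex.Re z].

(* R[i] carries its norm topology through the alias R[i]^o, and a derivative
   over the scalar field R[i] is a complex derivative. *)
Definition holomorphic_on (D : set R[i]) (F : R[i] -> R[i]) : Prop :=
  forall z, D z -> derivable (F : R[i]^o -> R[i]^o) z 1.

Definition cexp (z : R[i]) : R[i] :=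
  (expR (complex.Re z))%:C * (cos (complex.Im z) +i* sin (complex.Im z)).

Definition cintegral (d : measure_display) (T : measurableType d) (mu : {measure set T -> \bar R})
    (D : set T) (f : T -> R[i]) : R[i] :=
  (\int[mu]_(x in D) complex.Re (f x)) +i* (\int[mu]_(x in D) complex.Im (f x)).

End Complex.

Section ZenSpace.
Variable R : realType.
Implicit Type nu : {measure set (measurableTypeR R) -> \bar R}.

Definition regular_measure nu : Prop :=
  forall A : set R, measurable A ->
    nu A = ereal_inf [set nu U | U in [set U : set R | open U /\ A `<=` U]] /\
    nu A = ereal_sup [set nu K | K in [set K : set R | compact K /\ K `<=` A]].

(* A measure on [0, +oo[ is represented by a measure on R that does not charge
   the negative half-line.  The quotients in the doubling condition are real
   numbers by the finiteness and positivity conditions, so fine loses nothing. *)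
Definition zen_measure nu : Prop :=
  [/\ nu `]-oo, 0[%classic = 0%E,
      regular_measure nu,
      forall r : R, 0 < r -> (0 < nu `[0%R, r[%classic < +oo)%E &
      (ereal_sup [set (fine (nu `[0%R, (2 * r)%R[%classic) / fine (nu `[0%R, r[%classic))%:E
                 | r in `]0%R, +oo[] < +oo)%E].

(* The closed half-plane is identified with [0, +oo[ * R. *)
Definition zen_sqnorm nu (F : R[i] -> R[i]) : \bar R :=
  ereal_sup [set (\int[nu \x @lebesgue_measure R]_(p in `[0%R, +oo[ `*` setT)
                   (Normc.normc (F ((p.1 + e)%R +i* p.2)) ^+ 2)%:E)%E
            | e in `]0, +oo[].

Definition zen_norm nu (F : R[i] -> R[i]) : \bar R :=
  (zen_sqnorm nu F `^ 2^-1)%E.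

(* Functions on the open half-plane are represented by total functions, whose
   values elsewhere play no role: neither holomorphy on the half-plane nor the
   norm depends on them. *)
Definition zen_space nu : set (R[i] -> R[i]) :=
  [set F | holomorphic_on (@right_half_plane R) F /\ (zen_sqnorm nu F < +oo)%E].

Definition zen_weight nu (t : R) : \bar R :=
  ((2 * pi)%:E * \int[nu]_(r in `[0%R, +oo[) (expR (- (2 * r * t)))%:E)%E.

Definition weighted_L2 (w : R -> \bar R) : set (R -> R[i]) :=
  [set f : R -> R[i] |
    [/\ measurable_fun (`]0, +oo[ : set R) (fun t => complex.Re (f t)),
        measurable_fun (`]0, +oo[ : set R) (fun t => complex.Im (f t)) &
        (\int[@lebesgue_measure R]_(t in `]0%R, +oo[)
           ((Normc.normc (f t) ^+ 2)%:E * w t) < +oo)%E]].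

Definition laplace (f : R -> R[i]) (z : R[i]) : R[i] :=
  cintegral (@lebesgue_measure R) `]0, +oo[ (fun t => cexp (- (t%:C * z)) * f t).

(* The equality is required only on the half-plane, where the functions of the
   space are meant to live. *)
Definition laplace_surjective nu : Prop :=
  forall F, zen_space nu F ->
    exists2 f, weighted_L2 (zen_weight nu) f &
      forall z, right_half_plane z -> laplace f z = F z.

(* Every bounded sequence has a subsequence whose image converges in norm. *)
Definition compact_operator nu
    (T : {linear (R[i] -> R[i]^o) -> (R[i] -> R[i]^o)}) : Prop :=
  (forall F, zen_space nu F -> zen_space nu (T F)) /\
  (forall F_ : nat -> R[i] -> R[i],
     (forall n, zen_space nu (F_ n)) ->
     (exists M : R, forall n, (zen_norm nu (F_ n) <= M%:E)%E) ->
     exists2 s : nat -> nat, {homo s : m n / (m < n)%N} &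
     exists2 G, zen_space nu G &
       zen_norm nu (T (F_ (s n)) - G) @[n --> \oo] --> 0%E).

Definition composition (phi : R[i] -> R[i]) (F : R[i] -> R[i]^o) :
  R[i] -> R[i]^o := F \o phi.

Fact composition_is_linear phi : linear (composition phi).
Proof. by []. Qed.

HB.instance Definition _ phi :=
  GRing.isLinear.Build R[i] (R[i] -> R[i]^o) (R[i] -> R[i]^o) *:%R
    (composition phi) (composition_is_linear phi).

End ZenSpace.

(* Main.v *)
Require Import Defs.
From HB Require Import structures.
From mathcomp Require Import all_boot all_order all_algebra.
From mathcomp Require Import complex.
From mathcomp Require Import all_classical all_reals all_analysis.
From mathcomp Require Import measurable_realfun ring lra.

(**
The Schwarz-Pick inequality gives [|phi z| <= C x] on the box
[x <= Re z < 2x, |Im z| < x] for all large [x].  Choose [N] large with respect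
to the doubling constant of [nu]; the functions [c x^N / (z + x)^N] with
[c^2 = 1 / (x nu[0, x))] are bounded in the Zen space, by a decomposition of
the half-plane into dyadic boxes, and tend to [0] uniformly as [x] tends to
infinity.  After composition with [phi] they are still of size at least a
constant times [c] on the box of scale [x], whose measure is [2 / c^2].  So if
a subsequence of the compositions converged in norm, two far apart terms of it
would differ on such a box by an amount bounded below, which is absurd.

Since [phi] is only assumed differentiable, Schwarz-Pick starts from Goursat's
lemma.  Applied to [f (exp w)] times trigonometric factors on the strip
[0 <= Im w <= 2 pi] it gives Caratheodory's inequality [|f'(0)| <= 2 Re f(0)]
for [f] of nonnegative real part on the unit disc, and a Cayley transform
turns this into [|phi' z| Re z <= Re (phi z)].
*)

Import Order.TTheory GRing.Theory Num.Theory.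
Import numFieldNormedType.Exports.

Local Open Scope classical_set_scope.
Local Open Scope complex_scope.
Local Open Scope ring_scope.

Set Implicit Arguments.
Unset Strict Implicit.
Unset Printing Implicit Defensive.

(** * Complex derivatives *)

Section ComplexNorm.
Variable R : realType.
Implicit Types z w : R[i].
Local Notation normc := Normc.normc.
Local Notation Re := complex.Re.
Local Notation Im := complex.Im.

Lemma normc_norm z : (normc z)%:C = `|z|.
Proof. by rewrite normc_def; case: z. Qed.

Lemma normc_ge0 z : 0 <= normc z.
Proof. by case: z => a b; exact: sqrtr_ge0. Qed.

Lemma sqr_normc z : normc z ^+ 2 = Re z ^+ 2 + Im z ^+ 2.
Proof. by case: z => a b /=; rewrite sqr_sqrtr// addr_ge0 ?sqr_ge0. Qed.

Lemma ler_sqr_le (x y : R) : 0 <= y -> x ^+ 2 <= y ^+ 2 -> x <= y.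
Proof. by move=> y0 h; case: (leP x y) => // yx; nra. Qed.

Lemma le_Re_normc z : `|Re z| <= normc z.
Proof.
apply: ler_sqr_le; first exact: normc_ge0.
by rewrite sqr_normc real_normK ?num_real// lerDl sqr_ge0.
Qed.

Lemma le_Im_normc z : `|Im z| <= normc z.
Proof.
apply: ler_sqr_le; first exact: normc_ge0.
by rewrite sqr_normc real_normK ?num_real// lerDr sqr_ge0.
Qed.

Lemma le_normc_ReIm z : normc z <= `|Re z| + `|Im z|.
Proof.
apply: ler_sqr_le; first by rewrite addr_ge0.
rewrite sqr_normc sqrrD !real_normK ?num_real//.
by rewrite [leRHS]addrAC lerDl mulrn_wge0// mulr_ge0.
Qed.

Lemma normcX z n : normc (z ^+ n) = normc z ^+ n.
Proof.
by elim: n => [|n ih]; rewrite ?expr0 ?Normc.normc1// !exprS Normc.normcM ih.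
Qed.

Lemma normcR (x : R) : normc x%:C = `|x|.
Proof. by rewrite /= expr0n/= addr0 sqrtr_sqr. Qed.

Lemma normc_gt0 z : (0 < normc z) = (z != 0).
Proof.
rewrite lt0r normc_ge0 andbT; congr negb; apply/eqP/eqP => [|->].
  exact: Normc.eq0_normc.
exact: Normc.normc0.
Qed.

(** The norm of [R[i]] takes its values in [R[i]]; with [normc] the first-order expansion becomes an
    estimate over [R], open to [lra] and [nra]. *)
Lemma is_derive_normc (f : R[i]^o -> R[i]^o) (z d : R[i]^o) :
  is_derive z 1 f d -> forall e : R, 0 < e -> exists2 r : R, 0 < r &
    forall w, normc (w - z) < r ->
      normc (f w - f z - d * (w - z)) <= e * normc (w - z).
Proof.
move=> [df <-] e e0.
have /cvg_ex[l hl] := df.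
have -> : 'D_1 f z = l by apply: cvg_lim.
have eC0 : (0 : R[i]) < e%:C by rewrite ltcR.
move/cvgrPdist_le/(_ _ eC0) : hl => [r]; rewrite /= => r0 hr.
(* Positive elements of [R[i]] are real. *)
have rE : r = (Re r)%:C by rewrite RRe_real// gtr0_real.
exists (Re r); first by rewrite -ltcR -rE.
move=> w wr; have [->|wz] := eqVneq w z.
  by rewrite !subrr mulr0 subr0 Normc.normc0 mulr0.
have wz0 : w - z != 0 by rewrite subr_eq0.
have := hr (w - z); rewrite /= sub0r normrN -normc_norm rE ltcR => /(_ wr wz0).
rewrite /= -normc_norm lecR => h.
have -> : f w - f z - l * (w - z) = - ((l - (w - z)^-1 * (f w - f z)) * (w - z)).
  by field.
rewrite normcN Normc.normcM ler_wpM2r ?normc_ge0//.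
by move: h; rewrite -[_%:A]/(_ * 1) mulr1 subrK.
Qed.

Lemma is_derive_continuous (f : R[i]^o -> R[i]^o) (z d : R[i]^o) :
  is_derive z 1 f d -> forall e : R, 0 < e -> exists2 r : R, 0 < r &
    forall w, normc (w - z) < r -> normc (f w - f z) < e.
Proof.
move=> /is_derive_normc/(_ 1 ltr01)[r r0 hr] e e0.
have d0 := normc_ge0 d.
exists (Num.min r (e / (2 + normc d))).
  by rewrite lt_min r0 divr_gt0//; lra.
move=> w; rewrite lt_min => /andP[/hr h1].
rewrite ltr_pdivlMr; last lra.
move=> h2.
have : normc (f w - f z) <= 1 * normc (w - z) + normc d * normc (w - z).
  rewrite -Normc.normcM.
  by rewrite (le_trans _ (lerD h1 (lexx _)))// (le_trans _ (le_normcD _ _))// subrK.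
have := normc_ge0 (w - z).
nra.
Qed.

Lemma is_derive_of_normc (f : R[i]^o -> R[i]^o) (z d : R[i]^o) :
  (forall e : R, 0 < e -> exists2 r : R, 0 < r &
    forall w, normc (w - z) < r ->
      normc (f w - f z - d * (w - z)) <= e * normc (w - z)) ->
  is_derive z 1 f d.
Proof.
move=> h.
have H : (fun h : R[i]^o => h^-1 *: ((f \o shift z) (h *: (1 : R[i]^o)) - f z)) @ 0^' --> (d : R[i]^o).
  apply/cvgrPdist_le => e e0.
  have eE : e = (Re e)%:C by rewrite RRe_real// gtr0_real.
  have [r r0 hr] := h (Re e) ltac:(by rewrite -ltcR -eE).
  exists r%:C => /=; first by rewrite ltcR.
  move=> w; rewrite /= sub0r normrN -normc_norm ltcR => wr w0.
  have := hr (w + z); rewrite addrK => /(_ wr).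
  rewrite -[w%:A]/(w * 1) mulr1 => {}hr.
  have -> : d - w^-1 *: (f (w + z) - f z) = - ((f (w + z) - f z - d * w) / w).
    rewrite -[_ *: _]/(_ * _); by field.
  rewrite normrN -normc_norm eE lecR Normc.normcM Normc.normcV.
  by rewrite ler_pdivrMr// normc_gt0.
apply: DeriveDef; first by apply/cvg_ex; exists d.
exact: cvg_lim.
Qed.

Lemma is_derive_comp (f g : R[i]^o -> R[i]^o) (z a b : R[i]^o) :
  is_derive z 1 f a -> is_derive (f z) 1 g b -> is_derive z 1 (g \o f) (b * a).
Proof.
move=> df dg; apply: is_derive_of_normc => e e0.
have a0 := normc_ge0 a; have b0 := normc_ge0 b.
(* The outer error is measured against [normc D <= (normc a + 1) * normc (w - z)], which uses that
   the inner tolerance is at most 1; each of the two errors then costs at most half of [e]. *)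
have e1 : 0 < e / (2 * (normc a + 1)) by rewrite divr_gt0//; lra.
have e2 : 0 < Num.min 1 (e / (2 * (normc b + 1))).
  by rewrite lt_min ltr01 divr_gt0//; lra.
have [rg rg0 hg] := is_derive_normc dg e1.
have [rf rf0 hf] := is_derive_normc df e2.
have [rc rc0 hc] := is_derive_continuous df rg0.
exists (Num.min rf rc); first by rewrite lt_min rf0.
move=> w; rewrite lt_min => /andP[/hf {}hf /hc/hg {}hg] /=.
set D := f w - f z in hf hg *.
have D1 : normc D <= normc (D - a * (w - z)) + normc a * normc (w - z).
  by rewrite -Normc.normcM (le_trans _ (le_normcD _ _))// subrK.
have -> : g (f w) - g (f z) - b * a * (w - z) =
    (g (f w) - g (f z) - b * D) + b * (D - a * (w - z)) by ring.
rewrite (le_trans (le_normcD _ _))// Normc.normcM.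
move: hf hg D1 e2 e1; set m := Num.min _ _; set k := e / _.
set X := normc (D - _); set Y := normc (_ - b * D); set W := normc (w - z).
have W0 : 0 <= W by exact: normc_ge0.
move=> hf hg D1 m0 k0.
have m1 : m <= 1 by rewrite /m ge_min lexx.
have m2 : m * (2 * (normc b + 1)) <= e.
  by rewrite -ler_pdivlMr ?ge_min ?lexx ?orbT//; lra.
have k1 : k * (2 * (normc a + 1)) = e by rewrite /k; field; lra.
have D2 : normc D <= (normc a + 1) * W by nra.
have : Y <= k * (normc a + 1) * W by rewrite (le_trans hg)// -mulrA ler_pM2l.
have : normc b * X <= (normc b + 1) * (m * W) by nra.
nra.
Qed.

End ComplexNorm.

(** * Goursat's lemma *)

Section Goursat.
Variable R : realType.
Local Notation mu := (@lebesgue_measure R).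

Lemma continuous_itv_integrable (f : R -> R) (a b : R) :
  (forall x, a <= x <= b -> {for x, continuous f}) ->
  mu.-integrable `[a, b] (EFin \o f).
Proof.
move=> fc; apply: continuous_compact_integrable; first exact: segment_compact.
by apply: continuous_in_subspaceT => x; rewrite inE/= in_itv/= => /fc.
Qed.

Lemma Rintegral_itv_split (f : R -> R) (a m b : R) :
  (forall x, a <= x <= b -> {for x, continuous f}) -> a <= m <= b ->
  \int[mu]_(x in `[a, b]) f x =
    \int[mu]_(x in `[a, m]) f x + \int[mu]_(x in `[m, b]) f x.
Proof.
move=> fc /andP[am mb]; have fi := continuous_itv_integrable fc.
have := @Rintegral_itvB _ f (BLeft a) (BRight b) m fi.
rewrite !bnd_simp => /(_ am mb).
rewrite Rintegral_itv_obnd_cbnd => [<-|]; first by rewrite addrC subrK.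
apply: integrableS fi => //; apply: subset_itvr => /=.
by rewrite bnd_simp.
Qed.

Lemma Rintegral_itv_near (f : R -> R) (a b k e : R) :
  (forall x, a <= x <= b -> {for x, continuous f}) -> a <= b ->
  (forall x, a <= x <= b -> `|f x - k| <= e) ->
  `|\int[mu]_(x in `[a, b]) f x - k * (b - a)| <= e * (b - a).
Proof.
move=> fc ab fk; have fi := continuous_itv_integrable fc.
have muab : fine (mu `[a, b]) = b - a.
  rewrite lebesgue_measure_itv/= lte_fin; case: ltgtP ab => //= -> _.
  by rewrite subrr.
have ci c : mu.-integrable `[a, b] (EFin \o cst c).
  by apply: continuous_itv_integrable => x _; exact: cst_continuous.
rewrite -muab -!Rintegral_cst//= -RintegralB//=; last exact: ci.
apply: (le_trans (le_normr_Rintegral _ _)) => //=.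
  apply: continuous_itv_integrable => x /fc ?.
  by apply: continuousB => //; exact: cst_continuous.
apply: le_Rintegral => //=.
- apply: continuous_itv_integrable => x /fc ?.
  apply: (@continuous_comp _ _ _ (fun x => f x - k) Num.norm).
    by apply: continuousB => //; exact: cst_continuous.
  exact: norm_continuous.
- exact: ci.
Qed.

(** Every left end point stays below every right end point, so the supremum of the left ones lies in
    all the intervals. *)
Lemma nested_itv (u v : nat -> R) :
  {homo u : m n / (m <= n)%N >-> m <= n} ->
  {homo v : m n / (m <= n)%N >-> n <= m} ->
  (forall n, u n <= v n) -> exists l, forall n, u n <= l <= v n.
Proof.
move=> ui vd uv.
have uvmn m n : u m <= v n.
  by rewrite (le_trans (ui _ _ (leq_maxl m n)))// (le_trans (uv _))// vd ?leq_maxr.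
exists (sup (range u)) => n; apply/andP; split.
  apply: ub_le_sup; last by exists n.
  by exists (v 0) => _ [m _ <-].
apply: ge_sup; first by exists (u 0), 0.
by move=> _ [m _ <-].
Qed.

(* The form [A dx + B dy] is differentiable at [(x0, y0)], with [dA/dy = dB/dx = be]. *)
Definition closed_form_at (A B : R -> R -> R) (x0 y0 : R) :=
  exists al be ga : R, forall e, 0 < e -> exists2 d, 0 < d &
    forall x y, `|x - x0| < d -> `|y - y0| < d ->
    `|A x y - A x0 y0 - (al * (x - x0) + be * (y - y0))|
      <= e * (`|x - x0| + `|y - y0|) /\
    `|B x y - B x0 y0 - (be * (x - x0) + ga * (y - y0))|
      <= e * (`|x - x0| + `|y - y0|).

(** Reflection in the diagonal, used to pass from continuity in the first variable to continuity in
    the second. *)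
Lemma closed_form_at_swap A B x0 y0 : closed_form_at A B x0 y0 ->
  closed_form_at (fun y x => B x y) (fun y x => A x y) y0 x0.
Proof.
move=> [al [be [ga h]]]; exists ga, be, al => e /h[d d0 {}h].
by exists d => // y x yd xd; have [] := h x y xd yd;
  rewrite [`|x - _| + _]addrC ![_ * (x - _) + _]addrC.
Qed.

Lemma closed_form_at_continuousl A B x0 y0 : closed_form_at A B x0 y0 ->
  {for x0, continuous (A ^~ y0)} /\ {for x0, continuous (B ^~ y0)}.
Proof.
move=> [al [be [ga h]]].
have key (f : R -> R) (c : R) : (forall e, 0 < e -> exists2 d, 0 < d &
    forall x, `|x - x0| < d -> `|f x - f x0 - c * (x - x0)| <= e * `|x - x0|) ->
  {for x0, continuous f}.
  move=> /(_ _ ltr01)[d d0 {}h]; apply/cvgrPdist_lt => e e0.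
  near=> x.
  have xd : `|x - x0| < d by near: x; exists d => //= x; rewrite /= distrC.
  have xe : `|x - x0| < e / (2 + `|c|).
    near: x; exists (e / (2 + `|c|)); first by rewrite /= divr_gt0// ltr_wpDr.
    by move=> x; rewrite /= distrC.
  move: xe; rewrite ltr_pdivlMr ?ltr_wpDr// => xe; rewrite distrC.
  have := h x xd; rewrite mul1r => {}h.
  have : `|f x - f x0| <= `|x - x0| + `|c| * `|x - x0|.
    rewrite -normrM (le_trans _ (lerD h (lexx _)))//.
    by rewrite (le_trans _ (ler_normD _ _))// subrK.
  have := normr_ge0 (x - x0); nra.
split; [apply: (key _ al)|apply: (key _ be)] => e /h[d d0 {}h];
  exists d => // x xd; have := h x y0 xd; rewrite subrr normr0 !mulr0 !addr0;
  by move=> /(_ d0)[].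
Unshelve. all: by end_near. Qed.

(* The integral of [A dx + B dy] along the boundary of [[a, b] x [c, d]]. *)
Definition rect_integral (A B : R -> R -> R) (a b c d : R) : R :=
  \int[mu]_(x in `[a, b]) (A x c - A x d) +
  \int[mu]_(y in `[c, d]) (B b y - B a y).

Section rectangle.
Variables (A B : R -> R -> R) (a b c d : R).
Hypothesis AB : forall x y, a <= x <= b -> c <= y <= d -> closed_form_at A B x y.

Let cA x y z : a <= x <= b -> c <= y <= d -> c <= z <= d ->
  {for x, continuous (fun x => A x y - A x z)}.
Proof.
move=> xab ycd zcd; apply: continuousB.
  by have [] := closed_form_at_continuousl (AB xab ycd).
by have [] := closed_form_at_continuousl (AB xab zcd).
Qed.

Let cB x y z : a <= y <= b -> a <= z <= b -> c <= x <= d ->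
  {for x, continuous (fun x => B y x - B z x)}.
Proof.
move=> yab zab xcd; apply: continuousB.
  by have [] := closed_form_at_continuousl (closed_form_at_swap (AB yab xcd)).
by have [] := closed_form_at_continuousl (closed_form_at_swap (AB zab xcd)).
Qed.

(** The integrals of [B] along the common edge at [m] cancel. *)
Lemma rect_integral_splitx m : a <= m <= b -> c <= d ->
  rect_integral A B a b c d = rect_integral A B a m c d + rect_integral A B m b c d.
Proof.
move=> /andP[am mb] cd; have ab := le_trans am mb.
rewrite /rect_integral (@Rintegral_itv_split _ a m) ?am//; last first.
  by move=> x xab; apply: cA; rewrite ?lexx ?cd.
suff -> : \int[mu]_(y in `[c, d]) (B b y - B a y) =
    \int[mu]_(y in `[c, d]) (B b y - B m y) +
    \int[mu]_(y in `[c, d]) (B m y - B a y) by ring.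
rewrite -RintegralD//=; last 2 first.
- by apply: continuous_itv_integrable => x xcd; apply: cB; rewrite ?lexx ?am ?ab.
- by apply: continuous_itv_integrable => x xcd; apply: cB; rewrite ?lexx ?am ?ab.
by apply: eq_Rintegral => y _; rewrite addrA subrK.
Qed.

Lemma rect_integral_splity m : a <= b -> c <= m <= d ->
  rect_integral A B a b c d = rect_integral A B a b c m + rect_integral A B a b m d.
Proof.
move=> ab /andP[cm md]; have cd := le_trans cm md.
rewrite /rect_integral (@Rintegral_itv_split _ c m) ?cm//; last first.
  by move=> x xab; apply: cB; rewrite ?lexx ?ab.
suff -> : \int[mu]_(x in `[a, b]) (A x c - A x d) =
    \int[mu]_(x in `[a, b]) (A x c - A x m) +
    \int[mu]_(x in `[a, b]) (A x m - A x d) by ring.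
rewrite -RintegralD//=; last 2 first.
- by apply: continuous_itv_integrable => x xcd; apply: cA; rewrite ?lexx ?cm ?cd.
- by apply: continuous_itv_integrable => x xcd; apply: cA; rewrite ?lexx ?cm ?cd.
by apply: eq_Rintegral => y _; rewrite addrA subrK.
Qed.

(** The linear parts [be * (c - d) * (b - a)] and [be * (b - a) * (d - c)] cancel, which takes the
    same [be] for both cross derivatives; only the errors remain. *)
Lemma rect_integral_small be e : a <= b -> c <= d ->
  (forall x, a <= x <= b -> `|A x c - A x d - be * (c - d)| <= e) ->
  (forall y, c <= y <= d -> `|B b y - B a y - be * (b - a)| <= e) ->
  `|rect_integral A B a b c d| <= e * ((b - a) + (d - c)).
Proof.
move=> ab cd hA hB.
have cA' x : a <= x <= b -> {for x, continuous (fun x => A x c - A x d)}.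
  by move=> xab; apply: cA; rewrite ?lexx ?cd.
have cB' x : c <= x <= d -> {for x, continuous (fun x => B b x - B a x)}.
  by move=> xab; apply: cB; rewrite ?lexx ?ab.
have h1 := Rintegral_itv_near cA' ab hA.
have h2 := Rintegral_itv_near cB' cd hB.
rewrite mulrDr (le_trans _ (lerD h1 h2))// (le_trans _ (ler_normD _ _))//.
by rewrite le_eqVlt /rect_integral; apply/orP; left; apply/eqP; congr Num.norm; ring.
Qed.

End rectangle.

Lemma rect_integral_split4 A B (a m b c n d : R) :
  (forall x y, a <= x <= b -> c <= y <= d -> closed_form_at A B x y) ->
  a <= m <= b -> c <= n <= d ->
  rect_integral A B a b c d =
    rect_integral A B a m c n + rect_integral A B a m n d +
    (rect_integral A B m b c n + rect_integral A B m b n d).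
Proof.
move=> AB amb cnd.
have /andP[am mb] := amb; have /andP[cn nd] := cnd.
rewrite (rect_integral_splitx AB amb (le_trans cn nd)).
congr (_ + _); apply: rect_integral_splity => // x y /andP[hx1 hx2] ycd.
  by apply: AB => //; rewrite hx1 (le_trans hx2).
by apply: AB => //; rewrite hx2 (le_trans am).
Qed.

(** Goursat's bisection: one of the four quarters always keeps at least a quarter of the integral,
    whereas near the common point of the nested rectangles differentiability makes the integral
    small compared with the squared perimeter. *)
Theorem closed_form_rect_integral A B (a b c d : R) : a <= b -> c <= d ->
  (forall x y, a <= x <= b -> c <= y <= d -> closed_form_at A B x y) ->
  rect_integral A B a b c d = 0.
Proof.
move=> ab cd AB; apply/eqP; rewrite -normr_eq0; apply: contraT => I0.
set I := `|_| in I0; have {}I0 : 0 < I by rewrite lt0r I0 normr_ge0.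
(* A rectangle of level [n] is recorded by its lower left corner; its sides are [w n] and [h n]. *)
pose w n : R := (b - a) / 2 ^+ n; pose h n : R := (d - c) / 2 ^+ n.
have w0 n : 0 <= w n by rewrite divr_ge0 ?subr_ge0 ?exprn_ge0.
have h0 n : 0 <= h n by rewrite divr_ge0 ?subr_ge0 ?exprn_ge0.
have wS n : w n = w n.+1 + w n.+1 by rewrite /w exprS; field; rewrite expf_neq0.
have hS n : h n = h n.+1 + h n.+1 by rewrite /h exprS; field; rewrite expf_neq0.
pose inside n (p q : R * R) := [/\ p.1 <= q.1, q.1 + w n.+1 <= p.1 + w n,
  p.2 <= q.2 & q.2 + h n.+1 <= p.2 + h n].
(* The factor 1/2 makes the inequality strict at level 0. *)
pose ok n (p : R * R) := [/\ a <= p.1, p.1 + w n <= b, c <= p.2, p.2 + h n <= d &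
  I / 2 / 4 ^+ n < `|rect_integral A B p.1 (p.1 + w n) p.2 (p.2 + h n)|].
have step n p : ok n p -> exists2 q, inside n p q & ok n.+1 q.
  move: p => [x y] [/= ax xb cy yd hI].
  have := wS n; have := hS n; have := w0 n.+1; have := h0 n.+1.
  set w' := w n.+1; set h' := h n.+1 => h'0 w'0 hE wE.
  apply: contrapT => noq.
  have key x' y' : x <= x' -> x' + w' <= x + w n -> y <= y' -> y' + h' <= y + h n ->
      `|rect_integral A B x' (x' + w') y' (y' + h')| <= I / 2 / 4 ^+ n.+1.
    move=> xx' x'w yy' y'h; rewrite leNgt; apply/negP => hI'.
    apply: noq; exists (x', y') => //; split => //=.
    - exact: le_trans xx'.
    - exact: le_trans xb.
    - exact: le_trans yy'.
    - exact: le_trans yd.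
  have AB' x0 y0 : x <= x0 <= x + w n -> y <= y0 <= y + h n -> closed_form_at A B x0 y0.
    by move=> /andP[? ?] /andP[? ?]; apply: AB; apply/andP; split; lra.
  move: hI; rewrite (@rect_integral_split4 _ _ x (x + w') _ y (y + h'))//; try lra.
  have h1 := key x y; have h2 := key x (y + h').
  have h3 := key (x + w') y; have h4 := key (x + w') (y + h').
  have eh : y + h' + h' = y + h n by lra.
  have ew : x + w' + w' = x + w n by lra.
  rewrite eh ew in h1 h2 h3 h4.
  have -> : I / 2 / 4 ^+ n = 4 * (I / 2 / 4 ^+ n.+1).
    by rewrite exprS; field; rewrite expf_neq0.
  have xw' : x + w' <= x + w n by rewrite wE addrA lerDl.
  have yh' : y + h' <= y + h n by rewrite hE addrA lerDl.
  have xx' : x <= x + w' by rewrite lerDl.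
  have yy' : y <= y + h' by rewrite lerDl.
  move: {h1}(h1 (lexx _) xw' (lexx _) yh') => h1.
  move: {h2}(h2 (lexx _) xw' yy' (lexx _)) => h2.
  move: {h3}(h3 xx' (lexx _) (lexx _) yh') => h3.
  move: {h4}(h4 xx' (lexx _) yy' (lexx _)) => h4.
  rewrite ltNge; move/negP; apply.
  rewrite (le_trans (ler_normD _ _))//.
  rewrite (le_trans (lerD (ler_normD _ _) (ler_normD _ _)))//; lra.
have /choice[f hf] : forall np : nat * (R * R), exists q, ok np.1 np.2 ->
    inside np.1 np.2 q /\ ok np.1.+1 q.
  move=> [n p]; have [/step[q]|] := pselect (ok n p); first by exists q.
  by exists p.
pose u := fix u n := if n is n'.+1 then f (n', u n') else (a, c).
have uok n : ok n (u n).
  elim: n => [|n ih]; last by have [] := hf (n, u n) ih.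
  rewrite /ok /w /h /= !expr0 !divr1 !subrKC; split => //.
  by rewrite ltr_pdivrMr// ltr_pMr// ltr1n.
have uin n : inside n (u n) (u n.+1) by have [] := hf (n, u n) (uok n).
have mono (g : nat -> R) : (forall n, g n <= g n.+1) -> {homo g : m n / (m <= n)%N >-> m <= n}.
  by move=> gS; apply: homo_leq => // y x z; exact: le_trans.
have [x0 hx0] : exists x0, forall n, (u n).1 <= x0 <= (u n).1 + w n.
  apply: nested_itv => [|m n mn|n]; last by rewrite lerDl.
    by apply: mono => n; have [] := uin n.
  rewrite -lerN2; apply: (mono (fun n => - ((u n).1 + w n))) mn => k.
  by rewrite lerN2; have [] := uin k.
have [y0 hy0] : exists y0, forall n, (u n).2 <= y0 <= (u n).2 + h n.
  apply: nested_itv => [|m n mn|n]; last by rewrite lerDl.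
    by apply: mono => n; have [] := uin n.
  rewrite -lerN2; apply: (mono (fun n => - ((u n).2 + h n))) mn => k.
  by rewrite lerN2; have [] := uin k.
have xyab : closed_form_at A B x0 y0.
  have := hx0 0%N; have := hy0 0%N; rewrite /w /h /= !expr0 !divr1 !subrKC.
  by move=> ? ?; apply: AB.
have [al [be [ga hd]]] := xyab.
pose s := (b - a) + (d - c).
have s0 : 0 <= s by rewrite addr_ge0// subr_ge0.
(* With this tolerance [E], the integral at level [n] will be at most [2 * E * (s / 2 ^+ n) ^+ 2],
   which is below [I / 2 / 4 ^+ n]. The added 1 keeps the denominator positive when [s = 0]. *)
have e0 : 0 < I / (4 * (s ^+ 2 + 1)).
  by rewrite divr_gt0// mulr_gt0// ltr_wpDl ?sqr_ge0.
have [del del0 {}hd] := hd _ e0.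
have [n hn] : exists n : nat, s / 2 ^+ n < del.
  have [n sn] : exists n : nat, s / del < n%:R.
    by exists (Num.bound (s / del)); apply: archi_boundP; rewrite divr_ge0// ltW.
  exists n; rewrite ltr_pdivrMr ?exprn_gt0//.
  rewrite ltr_pdivrMr// mulrC in sn; apply: (lt_le_trans sn).
  by rewrite ler_pM2l// -natrX ler_nat ltnW// ltn_expl.
have [/= ax xb cy yd] := uok n.
have /andP[x1 x2] := hx0 n; have /andP[y1 y2] := hy0 n.
have := w0 n; have := h0 n.
have whs : w n + h n = s / 2 ^+ n by rewrite /w /h -mulrDl.
rewrite -whs in hn.
move: x1 x2 y1 y2 ax xb cy yd hn.
move: (u n) => [x y] /=.
set W := w n in whs *; set H := h n in whs *.
move=> x1 x2 y1 y2 ax xb cy yd hn H0 W0.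
set E := I / _ in hd e0.
have xW x' : x <= x' <= x + W -> `|x' - x0| <= W /\ `|x' - x0| < del.
  move=> /andP[? ?]; have : `|x' - x0| <= W by rewrite ler_norml; lra.
  by move=> ?; split => //; lra.
have yH y' : y <= y' <= y + H -> `|y' - y0| <= H /\ `|y' - y0| < del.
  move=> /andP[? ?]; have : `|y' - y0| <= H by rewrite ler_norml; lra.
  by move=> ?; split => //; lra.
have lx : x <= x <= x + W by lra.
have rx : x <= x + W <= x + W by lra.
have ly : y <= y <= y + H by lra.
have ry : y <= y + H <= y + H by lra.
rewrite ltNge => /negP; case.
have -> : I / 2 / 4 ^+ n = 2 * E * (W + H) * ((x + W - x) + (y + H - y)) + 2 * E / 4 ^+ n.
  rewrite (_ : x + W - x + (y + H - y) = W + H); last by ring.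
  rewrite -[2 * E * _ * _]mulrA -[(W + H) * _]expr2 whs exprMn exprVn -exprM mulnC exprM.
  rewrite (_ : 2 ^+ 2 = 4 :> R); last by ring.
  rewrite /E; field; rewrite ?expf_neq0//=.
  by rewrite gt_eqF// ltr_wpDl ?sqr_ge0.
apply: (@le_trans _ _ (2 * E * (W + H) * ((x + W - x) + (y + H - y)))); last first.
  by rewrite lerDl divr_ge0 ?exprn_ge0// mulr_ge0// ltW.
apply: (@rect_integral_small _ _ _ _ _ _ _ be); try lra.
- by move=> x' y' ? ?; apply: AB; lra.
(* Subtracting the expansions at two opposite points cancels the [al] term and leaves [be] times the
   side, with two errors of at most [E * (W + H)]. *)
- move=> x' /xW[xw xd]; have [yw1 yd1] := yH _ ly; have [yw2 yd2] := yH _ ry.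
  have [+ _] := hd _ _ xd yd1; have [+ _] := hd _ _ xd yd2.
  have [] : E * (`|x' - x0| + `|y - y0|) <= E * (W + H) /\
            E * (`|x' - x0| + `|y + H - y0|) <= E * (W + H).
    by split; rewrite ler_pM2l//; lra.
  rewrite !ler_norml; lra.
- move=> y' /yH[yw yd']; have [xw1 xd1] := xW _ lx; have [xw2 xd2] := xW _ rx.
  have [_ +] := hd _ _ xd1 yd'; have [_ +] := hd _ _ xd2 yd'.
  have [] : E * (`|x - x0| + `|y' - y0|) <= E * (W + H) /\
            E * (`|x + W - x0| + `|y' - y0|) <= E * (W + H).
    by split; rewrite ler_pM2l//; lra.
  rewrite !ler_norml; lra.
Qed.

End Goursat.

(** * The complex exponential and means of periodic holomorphic functions *)

Section PeriodicMean.
Variable R : realType.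
Local Notation normc := Normc.normc.
Local Notation Re := complex.Re.
Local Notation Im := complex.Im.
Local Notation mu := (@lebesgue_measure R).

Lemma is_derive_norm (f : R -> R) (z d : R) :
  is_derive z 1 f d -> forall e : R, 0 < e -> exists2 r : R, 0 < r &
    forall w, `|w - z| < r -> `|f w - f z - d * (w - z)| <= e * `|w - z|.
Proof.
move=> [df <-] e e0.
have /cvg_ex[l hl] := df.
have -> : 'D_1 f z = l by apply: cvg_lim.
move/cvgrPdist_le/(_ _ e0) : hl => [r]; rewrite /= => r0 hr.
exists r => // w wr; have [->|wz] := eqVneq w z.
  by rewrite !subrr mulr0 subr0 normr0 mulr0.
have wz0 : w - z != 0 by rewrite subr_eq0.
have := hr (w - z); rewrite /= sub0r normrN => /(_ wr wz0).
rewrite -[_%:A]/(_ * 1) mulr1 subrK -[_ *: _]/(_ * _) => h.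
have -> : f w - f z - l * (w - z) = - ((l - (w - z)^-1 * (f w - f z)) * (w - z)).
  by field.
by rewrite normrN normrM ler_wpM2r.
Qed.

Lemma cexpD (z w : R[i]) : cexp (z + w) = cexp z * cexp w.
Proof.
case: z w => [a b] [c d]; rewrite /cexp /= expRD cosD sinD.
by apply/eqP; rewrite eq_complex /=; apply/andP; split; apply/eqP; ring.
Qed.

Lemma normc_cexp (z : R[i]) : normc (cexp z) = expR (Re z).
Proof.
rewrite /cexp Normc.normcM normcR ger0_norm ?expR_ge0//=.
by rewrite cos2Dsin2 sqrtr1 mulr1.
Qed.

Lemma cexp_neq0 (z : R[i]) : cexp z != 0.
Proof. by rewrite -normc_gt0 normc_cexp expR_gt0. Qed.

(** By [cexpD] only the expansion at 0 matters, and there it follows from the real derivatives of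
    [expR], [cos] and [sin] at 0. *)
Lemma is_derive_cexp (z : R[i]^o) : is_derive z 1 (@cexp R : R[i]^o -> R[i]^o) (cexp z).
Proof.
apply: is_derive_of_normc => e e0.
pose k := expR (Re z); have k0 : 0 < k by exact: expR_gt0.
(* The expansion at 0 will have error at most [12 * e' * normc h], a generous count; translation to
   [z] multiplies it by [k], the modulus of [cexp z]. *)
pose e' := Num.min 1 (e / (12 * k)).
have e'0 : 0 < e' by rewrite lt_min ltr01 divr_gt0// mulr_gt0.
have e'1 : e' <= 1 by rewrite ge_min lexx.
have e'k : 12 * k * e' <= e.
  by rewrite mulrC -ler_pdivlMr ?mulr_gt0// ge_min lexx orbT.
have [r1 r10 h1] := is_derive_norm (is_derive_expR (0 : R)) e'0.
have [r2 r20 h2] := is_derive_norm (is_derive_cos (0 : R)) e'0.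
have [r3 r30 h3] := is_derive_norm (is_derive_sin (0 : R)) e'0.
(* The radius [e' / 2] yields [X1]: the increment of [expR] is at most twice the real part of
   [h]. *)
exists (Num.min (e' / 2) (Num.min r1 (Num.min r2 r3))).
  by rewrite !lt_min r10 r20 r30 divr_gt0.
move=> w; set h := w - z.
have -> : w = z + h by rewrite /h addrC subrK.
rewrite !lt_min => /and4P[he hr1 hr2 hr3].
rewrite cexpD -{2}[cexp z]mulr1 -!mulrBr Normc.normcM normc_cexp -/k.
have ha := le_Re_normc h; have hb := le_Im_normc h.
have := h1 (Re h); have := h2 (Im h); have := h3 (Im h).
rewrite !subr0 expR0 cos0 sin0 subr0 oppr0 mul0r subr0 !mul1r.
move=> /(_ (le_lt_trans hb hr3)) {}h3 /(_ (le_lt_trans hb hr2)) {}h2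
  /(_ (le_lt_trans ha hr1)) {}h1.
suff : normc (cexp h - 1 - h) <= 12 * e' * normc h.
  move=> H; rewrite (le_trans (ler_wpM2l (ltW k0) H))// mulrA.
  by rewrite ler_wpM2r ?normc_ge0// (le_trans _ e'k)// le_eqVlt; apply/orP; left; apply/eqP; ring.
rewrite (le_trans (le_normc_ReIm _))//.
move: ha hb h1 h2 h3 he; set N := normc h; case: (h) => a b /=.
rewrite !mul0r !subr0 addr0 => ha hb h1 h2 h3 he.
have N0 := le_trans (normr_ge0 _) ha.
have Re1 : expR a * cos b - 1 - a = (expR a - 1 - a) + expR a * (cos b - 1) by ring.
have Im1 : expR a * sin b - b = (expR a - 1) * sin b + (sin b - b) by ring.
have X1 : `|expR a - 1| <= e'.
  have := ler_normD (expR a - 1 - a) a; rewrite subrK => /le_trans; apply.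
  have : e' * `|a| <= `|a| by rewrite ler_piMl.
  lra.
have X2 : expR a <= 2 by move: X1; rewrite ler_norml; lra.
have X3 : `|sin b| <= 2 * `|b|.
  have := ler_normD (sin b - b) b; rewrite subrK => /le_trans; apply.
  have : e' * `|b| <= `|b| by rewrite ler_piMl.
  lra.
have Y1 : `|expR a * (cos b - 1)| <= 2 * (e' * `|b|).
  by rewrite normrM ler_pM// ger0_norm ?expR_ge0.
have Y2 : `|(expR a - 1) * sin b| <= e' * (2 * `|b|) by rewrite normrM ler_pM.
have Z1 : e' * `|a| <= e' * N by rewrite ler_wpM2l// ltW.
have Z2 : e' * `|b| <= e' * N by rewrite ler_wpM2l// ltW.
have Z3 : 0 <= e' * N by rewrite mulr_ge0// ltW.
have W1 := ler_normD (expR a - 1 - a) (expR a * (cos b - 1)).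
have W2 := ler_normD ((expR a - 1) * sin b) (sin b - b).
rewrite ?oppr0 ?addr0 ?subr0 Re1 Im1; lra.
Qed.

(** The form is the imaginary part of [g dz], and by the Cauchy-Riemann equations both its cross
    derivatives are [Re d]. *)
Lemma derive_closed_form (g : R[i]^o -> R[i]^o) (x y : R) (d : R[i]^o) :
  is_derive ((x +i* y) : R[i]^o) 1 g d ->
  closed_form_at (fun x y => Im (g (x +i* y))) (fun x y => Re (g (x +i* y))) x y.
Proof.
move=> dg; exists (Im d), (Re d), (- Im d) => e e0.
have [r r0 hr] := is_derive_normc dg e0.
exists (r / 2) => [|x' y' xd yd]; first by rewrite divr_gt0.
have E : (x' +i* y') - (x +i* y) = (x' - x) +i* (y' - y) by [].
have := hr (x' +i* y'); rewrite E.
have hn : normc ((x' - x) +i* (y' - y)) <= `|x' - x| + `|y' - y| by exact: le_normc_ReIm.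
move=> hh.
have hnr : normc ((x' - x) +i* (y' - y)) < r by apply: (le_lt_trans hn); lra.
have {}hh := hh hnr.
have {}hh := le_trans hh (ler_wpM2l (ltW e0) hn).
set D := g _ - g _ - _ in hh.
have hR := le_trans (le_Re_normc D) hh; have hI := le_trans (le_Im_normc D) hh.
move: hR hI; rewrite /D; case: (g (x' +i* y')) (g (x +i* y)) d {D hh hr dg} => [a b] [a' b'] [p q] /=.
move=> hR hI; split.
  by rewrite (_ : b - b' - _ = b - b' - (p * (y' - y) + q * (x' - x)))//; ring.
by rewrite (_ : a - a' - _ = a - a' - (p * (x' - x) - q * (y' - y)))//; ring.
Qed.

(** Periodicity cancels the horizontal sides of a rectangle of height [2 * pi], so the mean of
    [Re g] over a vertical side does not depend on its abscissa, and far to the left it approaches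
    [L]. For [g = h \o cexp] this is the mean value property of [h] on circles around 0. *)
Lemma periodic_mean_ge0 (g : R[i]^o -> R[i]^o) (L s : R) :
  (forall w : R[i]^o, Re w < 0 -> derivable g w 1) ->
  (forall x, g (x +i* (2 * pi)) = g (x +i* 0)) ->
  (forall e, 0 < e -> exists M, forall w, Re w < M -> `|Re (g w) - L| <= e) ->
  s < 0 -> (forall y, 0 <= Re (g (s +i* y))) -> 0 <= L.
Proof.
move=> dg pg gL s0 gs; rewrite leNgt; apply/negP => L0.
(* With this tolerance the integral over the left side is at most [L * pi < 0], against a
   nonnegative one over the right side. *)
have [M hM] := gL (- L / 2) ltac:(lra).
pose a := Num.min s M - 1.
have as' : a < s by rewrite ltrBlDr gt_min ltrDl ltr01.
have aM : a < M by rewrite ltrBlDr gt_min ltrDl ltr01 orbT.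
have pi0 := pi_gt0 R.
have AB x y : a <= x <= s -> closed_form_at (fun x y => Im (g (x +i* y))) (fun x y => Re (g (x +i* y))) x y.
  move=> /andP[_ xs]; apply: derive_closed_form.
  exact/derivableP/dg/(le_lt_trans xs).
have := @closed_form_rect_integral _ _ _ a s 0 (2 * pi) (ltW as') _ (fun x y xs _ => AB x y xs).
rewrite /rect_integral => /(_ ltac:(lra)).
under eq_Rintegral do rewrite pg subrr.
rewrite Rintegral_cst// mul0r add0r.
have cB x y : a <= x <= s -> {for y, continuous (fun y => Re (g (x +i* y)))}.
  by move=> xs; have [] := closed_form_at_continuousl (closed_form_at_swap (AB x y xs)).
rewrite RintegralB//=; last 2 first.
- by apply: continuous_itv_integrable => y _; apply: cB; rewrite lexx ltW.
- by apply: continuous_itv_integrable => y _; apply: cB; rewrite lexx ltW.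
have h1 : 0 <= \int[mu]_(y in `[0, 2 * pi]) Re (g (s +i* y)) by exact: Rintegral_ge0.
have cBa y : 0 <= y <= 2 * pi -> {for y, continuous (fun y => Re (g (a +i* y)))}.
  by move=> _; apply: cB; rewrite lexx ltW.
have p2 : 0 <= 2 * pi :> R by rewrite mulr_ge0// ltW.
have hI y : 0 <= y <= 2 * pi -> `|Re (g (a +i* y)) - L| <= - L / 2.
  by move=> _; exact: hM.
have := Rintegral_itv_near cBa p2 hI.
rewrite ler_norml; have Lpi : L * pi < 0 by rewrite nmulr_rlt0.
move: h1 Lpi; clear; set I := Rintegral _ _ _; set J := Rintegral _ _ _.
lra.
Qed.

End PeriodicMean.

(** * The Schwarz-Pick inequality *)

Section SchwarzPick.
Variable R : realType.
Local Notation normc := Normc.normc.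
Local Notation Re := complex.Re.
Local Notation Im := complex.Im.

(** On a circle of radius [rho < 1], [Re f] times 1 plus a cosine is nonnegative; with the phase
    opposed to [d] its mean is [Re (f 0) - rho * normc d / 2]. *)
Lemma caratheodory_derive (f : R[i]^o -> R[i]^o) (d : R[i]^o) :
  (forall z : R[i]^o, normc z < 1 -> derivable f z 1) ->
  (forall z : R[i]^o, normc z < 1 -> 0 <= Re (f z)) ->
  is_derive (0 : R[i]^o) 1 f d -> normc d <= 2 * Re (f 0).
Proof.
move=> df f0 d0; rewrite leNgt; apply/negP => hlt.
set u := Re (f 0) in hlt.
have u0 : 0 <= u by apply: f0; rewrite Normc.normc0.
have nd0 : 0 < normc d by apply: le_lt_trans hlt; rewrite mulr_ge0.
have dn0 : d != 0 by rewrite -normc_gt0.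
(* The midpoint between [2 * u / normc d] and 1, so that the strict inequality survives at a radius
   below 1. *)
pose rho := (1 + 2 * u / normc d) / 2.
have [rho0 rho1 rhod] : [/\ 0 < rho, rho < 1 & 2 * u < rho * normc d].
  have q0 : 0 <= 2 * u / normc d by rewrite divr_ge0 ?mulr_ge0// ltW.
  have q1 : 2 * u / normc d < 1 by rewrite ltr_pdivrMr// mul1r.
  have qE : 2 * u / normc d * normc d = 2 * u by rewrite divfK// gt_eqF.
  by rewrite /rho; split; [lra|lra|nra].
(* The phase that attains the bound: [a] has modulus 1 and [a * d = - normc d]. *)
pose a : R[i] := - (conjc d / (normc d)%:C).
have ndC : (normc d)%:C != 0 :> R[i] by rewrite -normc_gt0 normcR normr_gt0 gt_eqF.
have ad : a * d = - (normc d)%:C.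
  rewrite /a mulNr mulrAC; congr (- _).
  have -> : conjc d * d = (normc d)%:C * (normc d)%:C.
    rewrite -rmorphM -expr2 sqr_normc; case: (d) => p q /=; apply/eqP.
    by rewrite eq_complex /=; apply/andP; split; apply/eqP; ring.
  by rewrite mulfK.
have na : normc a = 1.
  have : normc (a * d) = normc d by rewrite ad normcN normcR ger0_norm ?normc_ge0.
  rewrite Normc.normcM => /(congr1 (fun t => t / normc d)).
  by rewrite mulfK ?divff ?gt_eqF.
have nac : normc (conjc a) = 1.
  by rewrite -na; case: (a) => p q; rewrite /= sqrrN.
have rhoC : rho%:C != 0 :> R[i] by rewrite -normc_gt0 normcR normr_gt0 gt_eqF.
(* On [|z| = rho] the factors are real and [Re (h z) = Re (f z) (1 + cos t)],
   while [h z] tends to [Re (f 0) + a d rho / 2] as [z] tends to [0]. *)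
pose h (z : R[i]^o) : R[i]^o := (f z - f 0) * (2^-1 * a * rho%:C / z + (1 + 2^-1 * conjc a / rho%:C * z)) +
  u%:C * (1 + conjc a / rho%:C * z).
pose g : R[i]^o -> R[i]^o := h \o @cexp R.
have dh (z : R[i]^o) : z != 0 -> normc z < 1 -> derivable h z 1.
  move=> z0 /df dfz.
  apply: derivableD; last first.
    apply: derivableM; first exact: derivable_cst.
    apply: derivableD; first exact: derivable_cst.
    by apply: derivableM; [exact: derivable_cst|exact: derivable_id].
  apply: derivableM; first by apply: derivableB; [exact: dfz|exact: derivable_cst].
  apply: derivableD.
    apply: derivableM; first exact: derivable_cst.
    by apply: (@derivableV _ _ id); [exact: z0|exact: derivable_id].
  apply: derivableD; first exact: derivable_cst.
  by apply: derivableM; [exact: derivable_cst|exact: derivable_id].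
have dg (w : R[i]^o) : Re w < 0 -> derivable g w 1.
  move=> w0; have dhw : derivable h (cexp w) 1.
    by apply: dh; [exact: cexp_neq0|rewrite normc_cexp expR_lt1].
  by have [] := is_derive_comp (is_derive_cexp w) (derivableP dhw).
have pg x : g (x +i* (2 * pi)) = g (x +i* 0).
  rewrite /g /=; congr h; rewrite /cexp /=.
  by rewrite mulr_natl cos2pi sin2pi cos0 sin0.
have s0 : ln rho < 0 by rewrite ln_lt0// rho0.
have gs y : 0 <= Re (g (ln rho +i* y)).
  rewrite /g /= /h.
  have -> : cexp (ln rho +i* y) = rho%:C * (cos y +i* sin y) by rewrite /cexp /= lnK.
  set z := rho%:C * _.
  have fz : 0 <= Re (f z).
    by apply: f0; rewrite /z Normc.normcM normcR ger0_norm ?ltW//= cos2Dsin2 sqrtr1 mulr1.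
  (* [t] is the cosine of the angle between [a] and the direction of [z]. *)
  set t := Re (a * (cos y -i* sin y)).
  have t1 : 0 <= 1 + t.
    have : `|t| <= 1.
      apply: (le_trans (le_Re_normc _)).
      by rewrite Normc.normcM na/= sqrrN cos2Dsin2 sqrtr1 mulr1.
    by rewrite ler_norml; lra.
  have om0 : (cos y +i* sin y) != 0 :> R[i].
    by rewrite -normc_gt0/= cos2Dsin2 sqrtr1.
  have omV : (cos y +i* sin y)^-1 = (cos y -i* sin y) :> R[i].
    apply: (mulfI om0); rewrite divff//; apply/eqP; rewrite eq_complex /=.
    by have := cos2Dsin2 y; move=> h1; apply/andP; split; apply/eqP; [lra|ring].
  have -> : 2^-1 * a * rho%:C / z + (1 + 2^-1 * conjc a / rho%:C * z) = (1 + t)%:C.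
    have -> : 2^-1 * a * rho%:C / z = 2^-1 * (a * (cos y -i* sin y)).
      by rewrite -omV /z; field; rewrite om0.
    have -> : 2^-1 * conjc a / rho%:C * z = 2^-1 * (conjc a * (cos y +i* sin y)).
      by rewrite /z; field.
    rewrite addrCA -mulrDr.
    have -> : a * (cos y -i* sin y) + conjc a * (cos y +i* sin y) = 2 * t%:C.
      rewrite /t; case: (a) => p q; apply/eqP; rewrite eq_complex /=.
      by apply/andP; split; apply/eqP; ring.
    by rewrite mulKf ?rmorphD// pnatr_eq0.
  have -> : conjc a / rho%:C * z = conjc a * (cos y +i* sin y).
    by rewrite /z; field.
  suff -> : Re ((f z - f 0) * (1 + t)%:C + u%:C * (1 + conjc a * (cos y +i* sin y))) =
    Re (f z) * (1 + t) by rewrite mulr_ge0.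
  rewrite /t /u; case: (a) (f z) (f 0) => [p q] [b c] [b' c'] /=; ring.
(* The choice of [rho] makes this limit negative. It exists because [f z - f 0] compensates the pole
   of [h] at 0 and [(f z - f 0) / z] tends to [d]. *)
suff gL e : 0 < e -> exists M, forall w, Re w < M -> `|Re (g w) - (u - rho * normc d / 2)| <= e.
  by have := periodic_mean_ge0 dg pg gL s0 gs; lra.
move=> e0.
have e40 : 0 < e / 4 by rewrite divr_gt0.
have [r1 r10 h1] := is_derive_normc d0 e40.
have [r2 r20 h2] := is_derive_continuous d0 e40.
(* The error splits into three terms, bounded by [e / 4], [e / 2] and [e / 4] in [A1], [A2] and
   [A3]; the last radius serves the term with factor [u]. *)
pose del := Num.min (Num.min r1 r2) (Num.min rho (e / 4 * rho / (u + 1))).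
have del0 : 0 < del.
  by rewrite !lt_min r10 r20 rho0 /=; apply: divr_gt0; [exact: mulr_gt0|exact: ltr_wpDl].
exists (ln del) => w wM.
have nz : normc (cexp w) < del by rewrite normc_cexp -[del]lnK// ltr_expR.
rewrite /g /=; have z0 := cexp_neq0 w; set z := cexp w in nz z0 *.
move: nz; rewrite !lt_min -andbA => /and4P[z1 z2 z3 z4].
have := h1 z; have := h2 z; rewrite !subr0 => /(_ z2) {}h2 /(_ z1) {}h1.
have -> : u - rho * normc d / 2 = Re (u%:C + 2^-1 * (a * d) * rho%:C).
  rewrite ad (_ : 2^-1 = (2^-1 : R)%:C); last by rewrite fmorphV rmorph_nat.
  by rewrite /=; ring.
have -> : Re (h z) - Re (u%:C + 2^-1 * (a * d) * rho%:C) =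
    Re (h z - (u%:C + 2^-1 * (a * d) * rho%:C)).
  by case: (h z) (u%:C + 2^-1 * (a * d) * rho%:C) => [? ?] [? ?].
apply: (le_trans (le_Re_normc _)).
have -> : h z - (u%:C + 2^-1 * (a * d) * rho%:C) =
  (f z - f 0 - d * z) / z * (2^-1 * a * rho%:C) +
  ((f z - f 0) * (1 + 2^-1 * conjc a * (z / rho%:C)) + u%:C * (conjc a * (z / rho%:C))).
  by rewrite /h; field; rewrite ?z0 ?rhoC.
have n2 : normc (2^-1 : R[i]) = 2^-1.
  have -> : (2 : R[i]) = (2 : R)%:C by rewrite rmorph_nat.
  by rewrite Normc.normcV normcR ger0_norm.
have nzr : normc (z / rho%:C) = normc z / rho.
  by rewrite Normc.normcM Normc.normcV normcR ger0_norm ?ltW.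
have nz1 : normc z / rho <= 1 by rewrite ler_pdivrMr// mul1r ltW.
have nzp := normc_ge0 z.
have A1 : normc ((f z - f 0 - d * z) / z * (2^-1 * a * rho%:C)) <= e / 4.
  rewrite !Normc.normcM na n2 normcR (ger0_norm (ltW rho0)) Normc.normcV.
  have B1 : normc (f z - f 0 - d * z) / normc z <= e / 4.
    by rewrite ler_pdivrMr ?normc_gt0.
  have B2 : 0 <= normc (f z - f 0 - d * z) / normc z by rewrite divr_ge0 ?normc_ge0.
  nra.
have A2 : normc ((f z - f 0) * (1 + 2^-1 * conjc a * (z / rho%:C))) <= e / 4 * 2.
  rewrite Normc.normcM ler_pM ?normc_ge0//; first exact: ltW.
  rewrite (le_trans (le_normcD _ _))// Normc.normc1.
  rewrite [X in _ + X]Normc.normcM [X in _ + X * _]Normc.normcM nac n2 nzr; lra.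
have A3 : normc (u%:C * (conjc a * (z / rho%:C))) <= e / 4.
  rewrite 2!Normc.normcM nac nzr normcR (ger0_norm u0) mul1r mulrA ler_pdivrMr//.
  move: z4; rewrite ltr_pdivlMr; last lra.
  nra.
apply: (le_trans (le_normcD _ _)).
have := le_normcD ((f z - f 0) * (1 + 2^-1 * conjc a * (z / rho%:C))) (u%:C * (conjc a * (z / rho%:C))).
lra.
Qed.

Theorem schwarz_pick (phi : R[i] -> R[i]) (z : R[i]) :
  holomorphic_on (@right_half_plane R) phi ->
  (forall z, right_half_plane z -> right_half_plane (phi z)) ->
  right_half_plane z ->
  normc ('D_1 (phi : R[i]^o -> R[i]^o) (z : R[i]^o)) * Re z <= Re (phi z).
Proof.
move=> hphi mphi z0; pose x := Re z; have x0 : 0 < x := z0.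
(* This is the Cayley transform [(z + conjc z * w) / (1 - w)] of the disc onto the half-plane, in a
   form that shows [m 0 = z] and the derivative [2 * x] at 0. *)
pose m (w : R[i]^o) : R[i]^o := z + (2 * x)%:C * w / (1 - w).
have m0 : m 0 = z by rewrite /m mulr0 mul0r addr0.
have n1 (w : R[i]) : normc w < 1 -> 1 - w != 0.
  by move=> w1; rewrite subr_eq0; apply: contraTneq w1 => <-; rewrite Normc.normc1 ltxx.
have mz (w : R[i]) : normc w < 1 -> right_half_plane (m w).
  move=> w1; have w2 : Re w ^+ 2 + Im w ^+ 2 < 1.
    by rewrite -sqr_normc expr_lt1// normc_ge0.
  rewrite /right_half_plane /m /x /=; move: z0 w2; rewrite /right_half_plane /=.
  case: (z) (w) => [r s] [p q] /= r0 pq.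
  have D0 : 0 < (1 - p) ^+ 2 + (0 - q) ^+ 2 by nra.
  (* The unfolded real part of [m w] equals [Re z * (1 - normc w ^+ 2) / normc (1 - w) ^+ 2]. *)
  have -> : r + ((2 * r * p - 0 * q) * ((1 - p) / ((1 - p) ^+ 2 + (0 - q) ^+ 2)) -
      (2 * r * q + 0 * p) * - ((0 - q) / ((1 - p) ^+ 2 + (0 - q) ^+ 2))) =
      r * (1 - p ^+ 2 - q ^+ 2) / ((1 - p) ^+ 2 + (0 - q) ^+ 2).
    field; apply: lt0r_neq0; nra.
  by rewrite divr_gt0// mulr_gt0//; lra.
have dm (w : R[i]^o) : normc w < 1 -> derivable m w 1.
  move=> w1; apply: derivableD; first exact: derivable_cst.
  apply: derivableM.
    by apply: derivableM; [exact: derivable_cst|exact: derivable_id].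
  apply: (@derivableV _ _ (fun w : R[i]^o => (1 - w : R[i]^o))); first exact: n1.
  by apply: derivableB; [exact: derivable_cst|exact: derivable_id].
have dm0 : is_derive (0 : R[i]^o) 1 m (2 * x)%:C.
  apply: is_derive_of_normc => e e0.
  exists (Num.min (1 / 2) (e / (4 * x))).
    by rewrite lt_min !divr_gt0// mulr_gt0.
  move=> w; rewrite !subr0 m0 lt_min => /andP[w1 w2].
  have w0 := n1 w ltac:(lra).
  have -> : m w - z - (2 * x)%:C * w = (2 * x)%:C * w / (1 - w) * w.
    by rewrite /m; field; rewrite w0.
  rewrite Normc.normcM ler_wpM2r ?normc_ge0//.
  rewrite !Normc.normcM Normc.normcV normcR ger0_norm; last by rewrite mulr_ge0// ltW.
  have w3 : 1 / 2 <= normc (1 - w).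
    have := le_normcD (1 - w) w; rewrite subrK Normc.normc1; lra.
  rewrite ler_pdivrMr; last by rewrite normc_gt0.
  move: w2; rewrite ltr_pdivlMr; last by rewrite mulr_gt0.
  nra.
have d1 (w : R[i]^o) : normc w < 1 -> derivable ((phi : R[i]^o -> R[i]^o) \o m) w 1.
  move=> w1; have [] := is_derive_comp (derivableP (dm _ w1)) (derivableP (hphi _ (mz _ w1))).
  by [].
have d0 : is_derive (0 : R[i]^o) 1 ((phi : R[i]^o -> R[i]^o) \o m)
    ('D_1 (phi : R[i]^o -> R[i]^o) (z : R[i]^o) * (2 * x)%:C).
  have dphi : is_derive (m 0) 1 (phi : R[i]^o -> R[i]^o)
      ('D_1 (phi : R[i]^o -> R[i]^o) (z : R[i]^o)).
    by rewrite m0; apply: derivableP; exact: hphi.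
  exact: (is_derive_comp dm0 dphi).
have := caratheodory_derive d1 (fun w w1 => ltW (mphi _ (mz w w1))) d0.
rewrite /= m0 Normc.normcM normcR ger0_norm; last by rewrite mulr_ge0// ltW.
rewrite -/x; lra.
Qed.

End SchwarzPick.

(** * Growth of self-maps of the half-plane *)

Section Growth.
Variable R : realType.
Local Notation normc := Normc.normc.
Local Notation Re := complex.Re.
Local Notation Im := complex.Im.

Lemma is_derive_of_norm (f : R -> R) (z d : R) :
  (forall e : R, 0 < e -> exists2 r : R, 0 < r &
    forall w, `|w - z| < r -> `|f w - f z - d * (w - z)| <= e * `|w - z|) ->
  is_derive z 1 f d.
Proof.
move=> h.
have H : (fun h => h^-1 *: ((f \o shift z) (h *: 1) - f z)) @ 0^' --> d.
  apply/cvgrPdist_le => e e0.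
  have [r r0 hr] := h e e0.
  exists r => // w; rewrite /= sub0r normrN => wr w0.
  have := hr (w + z); rewrite addrK => /(_ wr).
  rewrite -[w%:A]/(w * 1) mulr1 => {}hr.
  have -> : d - w^-1 *: (f (w + z) - f z) = - ((f (w + z) - f z - d * w) / w).
    rewrite -[_ *: _]/(_ * _); by field.
  by rewrite normrN normrM normfV ler_pdivrMr// normr_gt0.
apply: DeriveDef; first by apply/cvg_ex; exists d.
exact: cvg_lim.
Qed.

Lemma is_derive_ReIm (f : R[i]^o -> R[i]^o) (t : R) (d : R[i]^o) :
  is_derive (t%:C : R[i]^o) 1 f d ->
  is_derive t 1 (fun s => Re (f s%:C)) (Re d) /\
  is_derive t 1 (fun s => Im (f s%:C)) (Im d).
Proof.
move=> df.
have key (l : R[i] -> R) : (forall z, `|l z| <= normc z) ->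
    (forall z w, l (z - w) = l z - l w) -> (forall z (x : R), l (z * x%:C) = l z * x) ->
    is_derive t 1 (fun s => l (f s%:C)) (l d).
  move=> ln lB lM; apply: is_derive_of_norm => e e0.
  have [r r0 hr] := is_derive_normc df e0; exists r => // s sr.
  have := hr s%:C; rewrite -rmorphB normcR => /(_ sr) {}hr.
  by apply: le_trans hr; rewrite -lM -!lB ln.
by split; apply: key => [z|[? ?] [? ?]|[? ?] x]//=;
  rewrite ?le_Re_normc ?le_Im_normc//; ring.
Qed.

Lemma le_of_derive_le0 (f df : R -> R) (T : R) : 0 <= T ->
  (forall t, 0 <= t <= T -> is_derive t 1 f (df t)) ->
  (forall t, 0 <= t <= T -> df t <= 0) -> f T <= f 0.
Proof.
move=> T0 fd df0.
apply: (@ler0_derive1_le_cc _ f 0 T) => //; last 2 first.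
- by rewrite in_itv/= lexx T0.
- by rewrite in_itv/= lexx T0.
- move=> x; rewrite in_itv/= => /andP[x0 xT].
  by have [] := fd x ltac:(by rewrite !ltW).
- move=> x; rewrite in_itv/= => /andP[x0 xT]; rewrite derive1E.
  have x0T : 0 <= x <= T by rewrite !ltW.
  by have [_ ->] := fd _ x0T; exact: df0.
- apply: continuous_in_subspaceT => x; rewrite inE/= in_itv/= => /fd[fx _].
  exact/differentiable_continuous/derivable1_diffP.
Qed.

(** Gronwall's argument: [u t * expR (- t)] does not increase, and then [v] and [- v] are compared
    with [u 0 * expR t], whose derivative dominates [u]. *)
Lemma le_growth_derive (u v du dv : R -> R) (T : R) : 0 <= T ->
  (forall t, 0 <= t <= T -> is_derive t 1 u (du t)) ->
  (forall t, 0 <= t <= T -> is_derive t 1 v (dv t)) ->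
  (forall t, 0 <= t <= T -> `|du t| <= u t) ->
  (forall t, 0 <= t <= T -> `|dv t| <= u t) ->
  u T <= expR T * u 0 /\ `|v T - v 0| <= (expR T - 1) * u 0.
Proof.
move=> T0 hu hv bu bv.
have dexpN (t : R) : is_derive t 1 (fun t => expR (- t)) (- expR (- t)).
  by have := is_derive1_comp (is_derive_expR (- t)) (is_deriveNid t 1); rewrite mulrN1.
have uE t : 0 <= t <= T -> u t <= expR t * u 0.
  move=> /andP[t0 tT].
  have sub s : 0 <= s <= t -> 0 <= s <= T by move=> /andP[-> st]; exact: le_trans tT.
  have := @le_of_derive_le0 (fun t => u t * expR (- t))
    (fun t => u t *: (- expR (- t)) + expR (- t) *: du t) t t0.
  rewrite oppr0 expR0 mulr1 expRN ler_pdivrMr ?expR_gt0// mulrC; apply.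
    by move=> s /sub hs; apply: is_deriveM; exact: hu.
  move=> s /sub hs; have := bu _ hs; rewrite ler_norml => /andP[_ h].
  rewrite -![_ *: _]/(_ * _); have := expR_gt0 (- s); nra.
split; first by apply: uE; rewrite T0 lexx.
have key (w dw : R -> R) : (forall t, 0 <= t <= T -> is_derive t 1 w (dw t)) ->
    (forall t, 0 <= t <= T -> dw t <= u t) -> w T - w 0 <= (expR T - 1) * u 0.
  move=> hw bw.
  have := @le_of_derive_le0 (fun t => w t - u 0 * expR t)
    (fun t => dw t - (u 0 *: expR t + expR t *: 0)) T T0.
  rewrite expR0 => H; suff : w T - u 0 * expR T <= w 0 - u 0 * 1 by lra.
  apply: H => t ht.
    by apply: is_deriveB; [exact: hw|apply: is_deriveM].
  rewrite scaler0 addr0 -[_ *: _]/(_ * _).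
  have := bw _ ht; have := uE _ ht; lra.
rewrite ler_norml; apply/andP; split.
  have := key (fun t => - v t) (fun t => - dv t).
  have h1 t : 0 <= t <= T -> is_derive t 1 (fun t => - v t) (- dv t).
    by move=> /hv ?; exact: is_deriveN.
  have h2 t : 0 <= t <= T -> - dv t <= u t.
    by move=> /bv; rewrite ler_norml; lra.
  by move=> /(_ h1 h2); lra.
by apply: (key _ _ hv) => t /bv; rewrite ler_norml => /andP[].
Qed.

Variable phi : R[i] -> R[i].
Hypothesis hphi : holomorphic_on (@right_half_plane R) phi.
Hypothesis mphi : forall z, right_half_plane z -> right_half_plane (phi z).

(** [gam] has hyperbolic speed at most 1, and by Schwarz-Pick so has its image under [phi];
    [le_growth_derive] then applies to the real and imaginary parts of the image. *)
Lemma path_growth (gam dgam : R[i]^o -> R[i]^o) (T : R) : 0 <= T ->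
  (forall t : R, 0 <= t <= T -> is_derive (t%:C : R[i]^o) 1 gam (dgam t%:C)) ->
  (forall t : R, 0 <= t <= T -> right_half_plane (gam t%:C)) ->
  (forall t : R, 0 <= t <= T -> normc (dgam t%:C) <= Re (gam t%:C)) ->
  Re (phi (gam T%:C)) <= expR T * Re (phi (gam 0%:C)) /\
  `|Im (phi (gam T%:C)) - Im (phi (gam 0%:C))| <= (expR T - 1) * Re (phi (gam 0%:C)).
Proof.
move=> T0 hg rg bg.
pose D t : R[i]^o := 'D_1 (phi : R[i]^o -> R[i]^o) (gam t%:C) * dgam t%:C.
have hD t : 0 <= t <= T ->
    is_derive (t%:C : R[i]^o) 1 ((phi : R[i]^o -> R[i]^o) \o gam) (D t).
  move=> ht; have dphi := derivableP (hphi (rg _ ht)).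
  exact: (is_derive_comp (hg _ ht) dphi).
have nD t : 0 <= t <= T -> normc (D t) <= Re (phi (gam t%:C)).
  move=> ht; rewrite /D Normc.normcM.
  apply: le_trans (schwarz_pick hphi mphi (rg _ ht)).
  by rewrite ler_wpM2l ?normc_ge0// bg.
apply: (@le_growth_derive (fun t => Re (phi (gam t%:C))) (fun t => Im (phi (gam t%:C)))
  (fun t => Re (D t)) (fun t => Im (D t))) => //.
- by move=> t /hD/is_derive_ReIm[].
- by move=> t /hD/is_derive_ReIm[].
- by move=> t /nD; exact: le_trans (le_Re_normc _).
- by move=> t /nD; exact: le_trans (le_Im_normc _).
Qed.

(** From 1 the point is reached along the real axis in hyperbolic time [ln x], which costs a factor
    [x], and then vertically in time at most 1, which costs a constant factor. *)
Theorem self_map_linear_growth : exists2 C : R, 0 < C &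
  forall x y, 1 <= x -> `|y| <= x -> normc (phi (x +i* y)) <= C * x.
Proof.
pose u1 := Re (phi 1); pose v1 := Im (phi 1).
have e1 : 1 <= expR 1 :> R by have := expR_ge1Dx (1 : R); lra.
have u10 : 0 < u1 by apply: mphi; rewrite /right_half_plane /= ltr01.
(* One multiple of [expR 1 * u1] bounds the real part; the other two bound the changes of the
   imaginary part along the two paths. *)
exists (3 * expR 1 * u1 + `|v1|).
  by rewrite ltr_pwDl// !mulr_gt0// expR_gt0.
move=> x y x1 yx; have x0 : 0 < x by lra.
(* The path is [cexp] itself, whose speed on the real axis equals its real part. *)
have [h1 h2] : Re (phi x%:C) <= x * u1 /\ `|Im (phi x%:C) - v1| <= (x - 1) * u1.
  have cE t : cexp (t%:C : R[i]) = (expR t)%:C.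
    by rewrite /cexp /= cos0 sin0 -[RHS]mulr1.
  have := @path_growth (@cexp R) (@cexp R) (ln x) (ln_ge0 x1).
  rewrite !cE expR0 lnK//; apply => t _; first exact: is_derive_cexp.
    by rewrite cE /right_half_plane /= expR_gt0.
  by rewrite normc_cexp cE.
(* The sign of [y], set to 1 at 0 so that the vertical path always has speed [x]. *)
have [sg [sg1 sgy]] : exists sg : R, `|sg| = 1 /\ sg * `|y| = y.
  exists (if 0 <= y then 1 else -1); case: (leP 0 y) => y0.
    by rewrite normr1 mul1r ger0_norm.
  by rewrite normrN1 mulN1r ltr0_norm// opprK.
have [h3 h4] : Re (phi (x +i* y)) <= expR (`|y| / x) * Re (phi x%:C) /\
    `|Im (phi (x +i* y)) - Im (phi x%:C)| <= (expR (`|y| / x) - 1) * Re (phi x%:C).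
  pose gam (w : R[i]^o) : R[i]^o := x%:C + (0 +i* (sg * x)) * w.
  have gE t : gam t%:C = x +i* (sg * x * t).
    by apply/eqP; rewrite eq_complex /=; apply/andP; split; apply/eqP; ring.
  have T0 : 0 <= `|y| / x by rewrite divr_ge0// ltW.
  have dgam (t : R) : is_derive (t%:C : R[i]^o) 1 gam (0 +i* (sg * x)).
    apply: is_derive_of_normc => e e0; exists 1 => // w _.
    rewrite (_ : gam w - gam t%:C - _ = 0); last by rewrite /gam; ring.
    by rewrite Normc.normc0 mulr_ge0 ?normc_ge0// ltW.
  have rgam t : right_half_plane (gam t%:C) by rewrite gE.
  have bgam t : normc (0 +i* (sg * x)) <= Re (gam t%:C).
    by rewrite gE /= expr0n add0r sqrtr_sqr normrM sg1 mul1r gtr0_norm.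
  have := path_growth (dgam := fun=> 0 +i* (sg * x)) T0 (fun t _ => dgam t)
    (fun t _ => rgam t) (fun t _ => bgam t).
  rewrite !gE mulr0 (_ : sg * x * (`|y| / x) = y)//.
  by rewrite -[in RHS]sgy; field; rewrite gt_eqF.
have ey : expR (`|y| / x) <= expR 1 by rewrite ler_expR ler_pdivrMr// mul1r.
have ux0 : 0 < Re (phi x%:C) by apply: mphi; rewrite /right_half_plane.
have uz0 : 0 < Re (phi (x +i* y)) by apply: mphi; rewrite /right_half_plane.
apply: (le_trans (le_normc_ReIm _)); rewrite gtr0_norm//.
have t1 := ler_normD (Im (phi (x +i* y)) - Im (phi x%:C)) (Im (phi x%:C)).
have t2 := ler_normD (Im (phi x%:C) - v1) v1.
rewrite !subrK in t1 t2.
have ex : expR (`|y| / x) * Re (phi x%:C) <= expR 1 * (x * u1).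
  by rewrite ler_pM ?expR_ge0// ltW.
have xu : x * u1 <= expR 1 * (x * u1) by rewrite ler_peMl// mulr_ge0// ltW.
have vx : `|v1| <= `|v1| * x by rewrite ler_peMr.
lra.
Qed.

End Growth.

(** * Test functions in Zen spaces *)

Section MeasurableLocal.
Variable R : realType.
Local Notation T := (measurableTypeR R).

(** [P] is open relative to [D]. Pairs carry the product sigma-algebra, so the set is written as the
    trace on [D] of a countable union of boxes with rational centres. *)
Lemma measurable_local (D P : set (T * T)) : measurable D ->
  (forall p, D p -> P p -> exists2 d : R, 0 < d & forall q, D q ->
     `|q.1 - p.1| < d -> `|q.2 - p.2| < d -> P q) ->
  measurable (D `&` P).
Proof.
move=> mD loc.
pose box (i : rat * rat * nat) : set (T * T) :=
  `](ratr i.1.1 - i.2.+1%:R^-1 : R), (ratr i.1.1 + i.2.+1%:R^-1 : R)[ `*`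
  `](ratr i.1.2 - i.2.+1%:R^-1 : R), (ratr i.1.2 + i.2.+1%:R^-1 : R)[.
have boxP i p : box i p <-> `|p.1 - ratr i.1.1| < i.2.+1%:R^-1 /\
    `|p.2 - ratr i.1.2| < i.2.+1%:R^-1.
  rewrite /box /setX /= !in_itv /= !ltr_norml.
  have tri (x c k : R) : (c - k < x < c + k) = (- k < x - c < k).
    by apply/andP/andP => -[? ?]; split; lra.
  by rewrite !tri.
pose good i := forall q, D q -> box i q -> P q.
have -> : D `&` P = D `&` \bigcup_i (if `[< good i >] then box i else set0).
  apply/seteqP; split=> p [Dp]; last first.
    by move=> [i _]; case: asboolP => // gi bp; split => //; exact: gi.
  move=> Pp; split => //; have [d d0 hd] := loc _ Dp Pp.
  (* All points of a box of half-side [k.+1%:R^-1] containing [p] lie within twice that distance of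
     [p] in each coordinate. *)
  have [k hk] : exists k : nat, 2 * k.+1%:R^-1 < d.
    exists (Num.bound (2 / d)); rewrite ltr_pdivrMr// mulrC -ltr_pdivrMr//.
    by apply: (lt_trans (archi_boundP _)); rewrite ?ltr_nat// divr_ge0// ltW.
  have rq (c t : R) : 0 < c -> exists q : rat, `|t - ratr q| < c.
    move=> c0; have [q] := @rat_in_itvoo R (t - c) (t + c) ltac:(lra).
    by rewrite in_itv/= => /andP[? ?]; exists q; rewrite ltr_norml; lra.
  have k0 : 0 < k.+1%:R^-1 :> R by rewrite invr_gt0.
  have [q1 h1] := rq _ p.1 k0; have [q2 h2] := rq _ p.2 k0.
  exists (q1, q2, k) => //; case: asboolP => [_|]; first exact/boxP.
  have tri (c x y z : R) : 2 * c < d -> `|x - y| < c -> `|z - y| < c -> `|z - x| < d.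
    by rewrite !ltr_norml; lra.
  case=> q Dq /boxP[/= b1 b2]; apply: hd => //.
    exact: tri hk h1 b1.
  exact: tri hk h2 b2.
apply: measurableI => //; apply: countable_bigcupT_measurable => // i.
by case: ifP => // _; apply: measurableX; exact: measurable_itv.
Qed.

End MeasurableLocal.

Section ZenTestFunctions.
Variable R : realType.
Local Notation normc := Normc.normc.
Local Notation Re := complex.Re.
Local Notation Im := complex.Im.
Local Notation T := (measurableTypeR R).
Local Notation leb := (@lebesgue_measure R).
Local Notation quadrant := (`[0%R, +oo[%classic `*` setT : set (T * T)).

Lemma measurable_quadrant : measurable quadrant.
Proof. by apply: measurableX => //; exact: measurable_itv. Qed.

(** Superlevel sets are open relative to the quadrant by continuity of [F]; the shift [e] keeps the
    argument in the open half-plane on the edge [p.1 = 0]. *)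
Lemma measurable_sqnormc (F : R[i] -> R[i]) (e : R) :
  holomorphic_on (@right_half_plane R) F -> 0 < e ->
  measurable_fun quadrant (fun p : T * T => normc (F ((p.1 + e) +i* p.2)) ^+ 2).
Proof.
move=> hF e0; apply: (measurability _ (measurable_realfun.RGenOInfty.measurableE R)).
move=> _ [_ [a ->] <-].
apply: measurable_local; first exact: measurable_quadrant.
move=> [r y] /= [/= + _]; rewrite in_itv/= andbT => r0; rewrite in_itv/= andbT => ha.
set z := (r + e) +i* y; set f := normc (F z) in ha.
have zr : right_half_plane z by rewrite /right_half_plane /= ltr_wpDl.
have f0 : 0 <= f by exact: normc_ge0.
(* Chosen so that every [g >= 0] with [g > f - d] satisfies [g ^+ 2 > a]. *)
pose d := Num.min 1 ((f ^+ 2 - a) / (2 * f + 1)).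
have d0 : 0 < d by rewrite lt_min ltr01 divr_gt0//; lra.
have [rr rr0 hr] := is_derive_continuous (derivableP (hF _ zr)) d0.
exists (rr / 2) => [|[r' y'] _ /= h1 h2]; first by rewrite divr_gt0.
rewrite in_itv/= andbT; set z' := (r' + e) +i* y'.
have zz : normc (z' - z) < rr.
  apply: (le_lt_trans (le_normc_ReIm _)) => /=.
  by rewrite (_ : r' + e - (r + e) = r' - r); [lra|ring].
have := hr _ zz; have := le_normcD (F z' - F z) (F z) => hn hl.
have := le_normcD (F z - F z') (F z'); rewrite subrK -/f -normcN opprB => hm.
set g := normc (F z') in hm *.
have fdg : f - d < g by lra.
have d1 : d <= 1 by rewrite ge_min lexx.
have d2 : d * (2 * f + 1) <= f ^+ 2 - a.
  by rewrite -ler_pdivlMr ?ge_min ?lexx ?orbT//; lra.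
have g0 : 0 <= g by exact: normc_ge0.
move: fdg d1 d2 g0 f0 d0; clearbody g d f; clear => fdg d1 d2 g0 f0 d0.
case: (leP d f) => df; last nra.
have : (f - d) ^+ 2 <= g ^+ 2 by rewrite ler_sqr ?nnegrE ?subr_ge0// ltW.
nra.
Qed.

(** [k] is the least index of a dyadic box around the point. If [k > 0], the box of index [k - 1]
    misses the point, so the denominator is at least [4 ^+ (k - 1) * x ^+ 2]. *)
Lemma dyadic_bound (N : nat) (x r y : R) : 0 < x -> 0 <= r ->
  exists k : nat, [/\ r < 2 ^+ k * x, `|y| < 2 ^+ k * x &
    (x ^+ 2 / ((r + x) ^+ 2 + y ^+ 2)) ^+ N <= 4 ^+ N / 4 ^+ (N * k)].
Proof.
move=> x0 r0.
have exk : exists k, (r < 2 ^+ k * x) && (`|y| < 2 ^+ k * x).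
  pose s := Num.max r `|y|.
  have s0 : 0 <= s / x by rewrite divr_ge0 ?le_max ?r0// ltW.
  exists (Num.bound (s / x)).
  have : s < 2 ^+ Num.bound (s / x) * x.
    rewrite -ltr_pdivrMr//; apply: (lt_le_trans (archi_boundP s0)).
    by rewrite -natrX ler_nat ltnW// ltn_expl.
  by rewrite /s gt_max.
case: (ex_minnP exk) => k /andP[h1 h2] kmin.
exists k; split=> //.
have D0 : 0 < (r + x) ^+ 2 + y ^+ 2 by nra.
case: k {h1 h2} kmin => [|k] kmin.
  rewrite muln0 expr0 divr1 lerXn2r ?nnegrE//.
    by rewrite divr_ge0 ?sqr_ge0// ltW.
  by rewrite ler_pdivrMr//; nra.
have hy := real_normK (num_real y).
have : 4 ^+ k * x ^+ 2 <= (r + x) ^+ 2 + y ^+ 2.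
  rewrite (_ : 4 = 2 ^+ 2); last by ring.
  rewrite -exprM mulnC exprM -exprMn -hy.
  have t0 : 0 <= 2 ^+ k * x by rewrite mulr_ge0 ?exprn_ge0// ltW.
  have yn := normr_ge0 y.
  move: (2 ^+ k * x) t0 (kmin k) => t t0 tk.
  suff : ~~ ((r < t) && (`|y| < t)) by rewrite negb_and -!leNgt => /orP[h|h]; nra.
  by apply/negP => /tk; rewrite ltnn.
move=> h; rewrite mulnC exprM -expr_div_n lerXn2r ?nnegrE//.
  by rewrite divr_ge0 ?sqr_ge0// ltW.
rewrite ler_pdivrMr// mulrAC ler_pdivlMr ?exprn_gt0// [4 ^+ k.+1]exprS.
by rewrite mulrCA ler_pM2l// mulrC.
Qed.

Variable nu : {measure set T -> \bar R}.
Hypothesis nu_zen : zen_measure nu.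
Definition zen_mass (r : R) : R := fine (nu `[0%R, r[%classic).
Local Notation V := zen_mass.

Lemma zen_massE (r : R) : 0 < r -> nu `[0%R, r[%classic = (V r)%:E.
Proof.
have [_ _ h _] := nu_zen; move=> /h /andP[h0 hoo].
by rewrite /zen_mass fineK// ge0_fin_numE// ltW.
Qed.

Lemma zen_mass_gt0 (r : R) : 0 < r -> 0 < V r.
Proof.
by have [_ _ h _] := nu_zen; move=> r0; rewrite -lte_fin -zen_massE//; case/andP: (h _ r0).
Qed.

Lemma zen_mass_le (r s : R) : 0 < r -> r <= s -> V r <= V s.
Proof.
move=> r0 rs; rewrite -lee_fin -!zen_massE//; last exact: lt_le_trans rs.
by apply: le_measure; rewrite ?inE//; apply: subset_itvl; rewrite bnd_simp.
Qed.

Lemma zen_mass_doubling : exists2 D : R, 0 < D & forall r, 0 < r -> V (2 * r) <= D * V r.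
Proof.
have [_ _ _] := nu_zen; set S := [set _ | _ in _] => Soo.
have ub r : 0 < r -> ((V (2 * r) / V r)%:E <= ereal_sup S)%E.
  by move=> r0; apply: ereal_sup_ubound; exists r => //=; rewrite in_itv/= r0.
have D0 : 0 < V (2 * 1) / V 1 by rewrite divr_gt0 ?zen_mass_gt0.
have Sfin : ereal_sup S = (fine (ereal_sup S))%:E.
  rewrite fineK// ge0_fin_numE//; apply: le_trans (ub 1 ltr01).
  by rewrite lee_fin ltW.
exists (fine (ereal_sup S)).
  by apply: (lt_le_trans D0); rewrite -lee_fin -Sfin ub.
by move=> r r0; rewrite -ler_pdivrMr ?zen_mass_gt0// -lee_fin -Sfin ub.
Qed.

(** The shift [e = a] in the norm carries it to the box with real part in [[a, 2 * a[], away from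
    the imaginary axis. *)
Definition box (a : R) : set (T * T) := `[0%R, a[%classic `*` `]- a, a[%classic.

Lemma measurable_box a : measurable (box a).
Proof. by apply: measurableX; exact: measurable_itv. Qed.

Lemma sub_box_quadrant a : box a `<=` quadrant.
Proof. by move=> [r y] [/= + _]; rewrite !in_itv/= => /andP[->]. Qed.

Lemma product_measure_box (a : R) : 0 < a -> (nu \x leb)%E (box a) = (V a * (2 * a))%:E.
Proof.
move=> a0; rewrite product_measure1E//= (zen_massE a0) lebesgue_measure_itv/= lte_fin.
rewrite (_ : - a < a); last lra.
by rewrite -EFinD -EFinM; congr (_ * _)%:E; ring.
Qed.

Definition zen_test (c : R) (N : nat) (x : R) (z : R[i]) : R[i] :=
  c%:C * (x%:C / (z + x%:C)) ^+ N.

Lemma sqnormc_zen_test c N x (z : R[i]) : 0 < x -> right_half_plane z ->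
  normc (zen_test c N x z) ^+ 2 =
    c ^+ 2 * (x ^+ 2 / ((Re z + x) ^+ 2 + Im z ^+ 2)) ^+ N.
Proof.
move=> x0 z0; rewrite /zen_test Normc.normcM normcX Normc.normcM Normc.normcV !normcR.
have sw (t : R) : (t ^+ N) ^+ 2 = (t ^+ 2) ^+ N by rewrite -!exprM mulnC.
rewrite exprMn sw [(_ / _) ^+ 2]exprMn exprVn !real_normK ?num_real// sqr_normc.
by case: (z) => a b /=; rewrite addr0.
Qed.

Lemma zen_test_le c N x (z : R[i]) : 0 < x -> right_half_plane z ->
  normc (zen_test c N x z) ^+ 2 <= c ^+ 2.
Proof.
move=> x0 z0; rewrite sqnormc_zen_test// ler_piMr ?sqr_ge0//.
have z0' : 0 < Re z by [].
have D0 : 0 < (Re z + x) ^+ 2 + Im z ^+ 2 by nra.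
rewrite exprn_ile1 ?divr_ge0 ?sqr_ge0//; first exact: ltW.
by rewrite ler_pdivrMr//; nra.
Qed.

Lemma zen_test_holomorphic c N x : 0 < x ->
  holomorphic_on (@right_half_plane R) (zen_test c N x).
Proof.
move=> x0 z z0.
pose q (w : R[i]^o) : R[i]^o := x%:C / (w + x%:C).
have dq : derivable q (z : R[i]^o) 1.
  apply: derivableM; first exact: derivable_cst.
  apply: (@derivableV _ _ (fun w : R[i]^o => w + x%:C : R[i]^o)).
    rewrite eq_complex negb_and /= gt_eqF//.
    by move: z0; rewrite /right_half_plane; case: (z) => a b /= a0; rewrite addr_gt0.
  by apply: derivableD; [exact: derivable_id|exact: derivable_cst].
have dX := derivableP (@exprn_derivable R[i] N (q z) 1).
have [dqN _] := is_derive_comp (derivableP dq) dX.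
by apply: derivableM; [exact: derivable_cst|exact: dqN].
Qed.

(** The box of index [k] has measure at most a multiple of [(2 * D) ^+ k], while the squared test
    function decays like [4 ^+ (N * k)]; the condition on [N] makes the ratio at most [2 ^- k]. *)
Lemma zen_test_sqnorm c N x D : 0 < x -> (forall r, 0 < r -> V (2 * r) <= D * V r) ->
  4 * D <= 4 ^+ N ->
  (zen_sqnorm nu (zen_test c N x) <= (c ^+ 2 * 4 ^+ N * 4 * (x * V x))%:E)%E.
Proof.
move=> x0 hD DN; apply: ge_ereal_sup => _ [e + <-].
rewrite /= in_itv/= andbT => e0.
have pow2 k : 0 < 2 ^+ k * x by rewrite mulr_gt0// exprn_gt0.
pose a k : R := c ^+ 2 * (4 ^+ N / 4 ^+ (N * k)).
have a0 k : 0 <= a k by rewrite mulr_ge0 ?sqr_ge0// divr_ge0 ?exprn_ge0.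
pose g k (p : T * T) : \bar R := ((a k)%:E * (\1_(box (2 ^+ k * x)) p)%:E)%E.
have g0 k p : (0 <= g k p)%E by rewrite mule_ge0 ?lee_fin.
have mQ := measurable_quadrant.
have m1 k : measurable_fun quadrant (\1_(box (2 ^+ k * x)) : T * T -> R).
  by apply: measurable_indic; exact: measurable_box.
have mg k : measurable_fun quadrant (g k).
  by apply: measurable_funeM; apply/measurable_EFinP; exact: m1.
(* The single term provided by [dyadic_bound] already dominates the integrand, uniformly in [e],
   since the shift only enlarges the denominator. *)
apply: (@le_trans _ _ (\int[nu \x leb]_(p in quadrant) \sum_(k <oo) g k p)%E).
  apply: ge0_le_integral => //.
  - by move=> p _; rewrite lee_fin sqr_ge0.
  - apply/measurable_EFinP; apply: measurable_sqnormc => //.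
    exact: zen_test_holomorphic.
  - by apply: ge0_emeasurable_sum => // k p _.
  move=> [r y] [/= + _]; rewrite in_itv/= andbT => r0.
  have [k [rk yk hk]] := dyadic_bound N y x0 r0.
  have zr : right_half_plane ((r + e) +i* y) by rewrite /right_half_plane /= ltr_wpDl.
  rewrite sqnormc_zen_test//=.
  apply: (@le_trans _ _ (g k (r, y))).
    rewrite /g indicE mem_set; last first.
      by split; rewrite /= in_itv/= ?r0//; rewrite -ltr_norml.
    rewrite mule1 lee_fin ler_wpM2l ?sqr_ge0//; apply: le_trans hk.
    have E0 : 0 < (r + x) ^+ 2 + y ^+ 2 by nra.
    have E1 : (r + x) ^+ 2 + y ^+ 2 <= (r + e + x) ^+ 2 + y ^+ 2 by nra.
    rewrite lerXn2r ?nnegrE ?divr_ge0 ?sqr_ge0 ?(ltW E0)// ?(le_trans (ltW E0))//.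
    by rewrite ler_wpM2l ?sqr_ge0// lef_pV2 ?posrE//; exact: lt_le_trans E1.
  apply: (le_trans _ (nneseries_lim_ge k.+1 _)) => //.
  by rewrite big_nat_recr//= leeDr// sume_ge0.
rewrite integral_nneseries//.
set K := c ^+ 2 * _ * _ * _.
have V0 := zen_mass_gt0 x0.
have K0 : 0 <= K.
  apply: mulr_ge0; last by rewrite mulr_ge0// ltW.
  by apply: mulr_ge0 => //; apply: mulr_ge0; [exact: sqr_ge0|exact: exprn_ge0].
(* The term of index [k] is compared with [K / 2 ^+ k.+1]. *)
apply: (le_trans _ (epsilon_trick0 xpredT K0)).
apply: lee_nneseries => k _; first by move=> _; apply: integral_ge0.
rewrite ge0_integralZl_EFin//; last by apply/measurable_EFinP; exact: m1.
rewrite integral_indic//; last exact: measurable_box.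
rewrite (setIidl (@sub_box_quadrant _)).
rewrite [X in (_ * X)%E](product_measure_box (pow2 k)) -EFinM lee_fin.
have VD : V (2 ^+ k * x) <= D ^+ k * V x.
  elim: k {g0 m1 mg} => [|k ih]; first by rewrite !expr0 !mul1r.
  rewrite !exprS -!mulrA (le_trans (hD _ (pow2 k)))// ler_wpM2l//.
  (* [D] is nonnegative because [V (2 * x)] and [V x] are positive. *)
  have := hD _ x0; have := zen_mass_gt0 (pow2 1%N); rewrite expr1 => ? ?.
  rewrite leNgt; apply/negP => ?; nra.
have D4 : 4 ^+ k * D ^+ k <= 4 ^+ (N * k).
  rewrite exprM -exprMn; apply: lerXn2r; rewrite ?nnegrE ?exprn_ge0//.
  have := hD _ x0; have := zen_mass_gt0 (pow2 1%N); rewrite expr1 => ? ?.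
  rewrite mulr_ge0// leNgt; apply/negP => ?; nra.
rewrite /a /K natrX [2 ^+ k.+1]exprS.
rewrite ler_pdivlMr ?mulr_gt0 ?exprn_gt0//.
set P4 := 4 ^+ (N * k) in D4 *; have P40 : 0 < P4 by rewrite exprn_gt0.
have -> : c ^+ 2 * (4 ^+ N / P4) * (V (2 ^+ k * x) * (2 * (2 ^+ k * x))) * (2 * 2 ^+ k) =
   c ^+ 2 * 4 ^+ N * 4 * x * ((2 ^+ k * 2 ^+ k) * V (2 ^+ k * x) / P4).
  by field; rewrite gt_eqF.
rewrite [leRHS]mulrA ler_wpM2l//.
  apply: mulr_ge0; last exact: ltW.
  by apply: mulr_ge0 => //; apply: mulr_ge0; [exact: sqr_ge0|exact: exprn_ge0].
rewrite -exprMn (_ : 2 * 2 = 4); last by ring.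
rewrite ler_pdivrMr//.
have P0 : 0 <= 4 ^+ k :> R by rewrite exprn_ge0.
by apply: (le_trans (ler_wpM2l P0 VD)); rewrite mulrA mulrC ler_pM2l.
Qed.

End ZenTestFunctions.

(** * Failure of compactness *)

Lemma sqr_normcD (R : realType) (z w : R[i]) :
  Normc.normc (z + w) ^+ 2 <= 2 * Normc.normc z ^+ 2 + 2 * Normc.normc w ^+ 2.
Proof.
have h := le_normcD z w; have a0 := normc_ge0 (z + w).
have := sqr_ge0 (Normc.normc z - Normc.normc w); nra.
Qed.

Lemma le_zen_sqnorm (R : realType) (nu : {measure set (measurableTypeR R) -> \bar R})
    (F : R[i] -> R[i]) (e : R) : 0 < e ->
  (\int[nu \x @lebesgue_measure R]_(p in `[0%R, +oo[ `*` setT)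
     (Normc.normc (F ((p.1 + e)%R +i* p.2)) ^+ 2)%:E <= zen_sqnorm nu F)%E.
Proof.
by move=> e0; apply: ereal_sup_ubound; exists e => //; rewrite /= in_itv/= e0.
Qed.

Theorem theorem6 (R : realType)
    (nu : {measure set (measurableTypeR R) -> \bar R})
    (nu_zen : zen_measure nu) (laplace_surj : laplace_surjective nu) :
  ~ exists phi : R[i] -> R[i],
      [/\ holomorphic_on (@right_half_plane R) phi,
          forall z, right_half_plane z -> right_half_plane (phi z) &
          compact_operator nu (composition phi)].
Proof.
move=> [phi [hphi mphi [stab cpt]]].
have [D D0 hD] := zen_mass_doubling nu_zen.
have [N hN] : exists N : nat, 4 * D <= 4 ^+ N.
  exists (Num.bound (4 * D)).
  apply: (le_trans (ltW (archi_boundP _))); first by rewrite mulr_ge0// ltW.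
  by rewrite -natrX ler_nat ltnW// ltn_expl.
have [C C0 hC] := self_map_linear_growth hphi mphi.
pose V := zen_mass nu.
pose x n : R := n.+1%:R.
have x0 n : 0 < x n by rewrite ltr0n.
have V0 n : 0 < V (x n) by exact: zen_mass_gt0.
(* Normalised by [c n ^+ 2 * (x n * V (x n)) = 1]: the norms are bounded independently of [n], while
   [c n] tends to 0. *)
pose c n : R := Num.sqrt (x n * V (x n))^-1.
have c2 n : c n ^+ 2 = (x n * V (x n))^-1.
  by rewrite sqr_sqrtr// invr_ge0 mulr_ge0// ltW.
have c20 n : 0 < c n ^+ 2 by rewrite c2 invr_gt0 mulr_gt0.
pose F n := zen_test (c n) N (x n).
pose K : R := 4 ^+ N * 4.
have K0 : 0 <= K by rewrite mulr_ge0 ?exprn_ge0.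
have FK n : (zen_sqnorm nu (F n) <= K%:E)%E.
  apply: (le_trans (zen_test_sqnorm nu_zen (c n) (x0 n) hD hN)).
  rewrite lee_fin c2 -/V -/K (_ : _ * (x n * V (x n)) = K)//.
  by rewrite /K; field; rewrite !gt_eqF.
have Fz n : zen_space nu (F n).
  by split; [exact: zen_test_holomorphic|exact: le_lt_trans (FK n) (ltry _)].
have FM : exists M : R, forall n, (zen_norm nu (F n) <= M%:E)%E.
  exists (K `^ 2^-1) => n; rewrite -poweR_EFin /zen_norm.
  have S0 : (0 <= zen_sqnorm nu (F n))%E.
    apply: le_trans (le_zen_sqnorm nu (F n) ltr01).
    by apply: integral_ge0 => p _; rewrite lee_fin sqr_ge0.
  by apply: gt0_ler_poweR => //; rewrite ?in_itv/= ?leey ?andbT ?lee_fin.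
have [s sinc [G [hG _] HG]] := cpt F Fz FM.
pose H n : R[i] -> R[i] := composition phi (F (s n)) - G.
have Hhol n : holomorphic_on (@right_half_plane R) (H n).
  move=> z z0; have [h1 _] := stab _ (Fz (s n)).
  by apply: derivableB; [exact: (h1 _ z0)|exact: (hG _ z0)].
have Hlow n (a : R) : 0 < a -> (\int[(nu \x @lebesgue_measure R)%E]_(p in box a)
    (Normc.normc (H n ((p.1 + a) +i* p.2)) ^+ 2)%:E <= zen_sqnorm nu (H n))%E.
  move=> a0; apply: le_trans (le_zen_sqnorm nu (H n) a0).
  apply: ge0_subset_integral.
  - exact: measurable_box.
  - exact: measurable_quadrant.
  - by apply/measurable_EFinP; exact: (measurable_sqnormc (Hhol n) a0).
  - by move=> p _; rewrite lee_fin sqr_ge0.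
  - exact: sub_box_quadrant.
(* On the shifted box of scale [x n] the growth bound gives
   [normc (phi z + x n) <= (2 * C + 1) * x n]. *)
pose q : R := ((2 * C + 1) ^+ 2)^-1.
have q0 : 0 < q by rewrite invr_gt0 exprn_gt0// addr_gt0// mulr_gt0.
pose c0 := q ^+ N; have c00 : 0 < c0 by rewrite exprn_gt0.
(* Two squared norms below [c0 / 8] will contradict the lower bound [c0 / 4] for their sum. *)
have eta0 : 0 < c0 / 8 by rewrite divr_gt0.
have [k0 hk0] : exists k0 : nat, forall k, (k0 <= k)%N -> (zen_sqnorm nu (H k) < (c0 / 8)%:E)%E.
  have d0 : (0 < ((c0 / 8) `^ 2^-1)%:E)%E by rewrite lte_fin powR_gt0.
  have [k0 _ hk0] := HG _ (open_ereal_lt' d0).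
  exists k0 => k /hk0 /=; rewrite -poweR_EFin; apply: contraTT.
  rewrite -!leNgt => h; rewrite /zen_norm.
  have c8 : (0%R <= (c0 / 8)%:E)%E by rewrite lee_fin ltW.
  apply: gt0_ler_poweR => //; rewrite in_itv/= leey andbT//.
  exact: le_trans h.
have s_ge n : (n <= s n)%N.
  by elim: n => // n ih; exact: (leq_ltn_trans ih (sinc _ _ (ltnSn n))).
set n := s k0.
have V1 : 0 < V 1 by exact: (zen_mass_gt0 nu_zen ltr01).
have A0 : 0 < c0 * c n ^+ 2 by rewrite mulr_gt0.
have AV : 0 < c0 * c n ^+ 2 * V 1 by rewrite mulr_gt0.
have [k1 hk1] : exists k1 : nat, 4 / (c0 * c n ^+ 2 * V 1) <= k1%:R.
  by eexists; apply: (ltW (archi_boundP _)); rewrite divr_ge0// ltW.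
(* With [n] fixed, [k] is so large that [F m] is negligible against [F n \o phi] on the box of scale
   [x n], which is [cm] below. *)
pose k := maxn k0 k1; set m := s k.
have cm : c m ^+ 2 <= c0 * c n ^+ 2 / 4.
  have Vm : V 1 <= V (x m) by apply: zen_mass_le => //; rewrite ler1n.
  have : 4 / (c0 * c n ^+ 2 * V 1) <= x m.
    apply: (le_trans hk1); rewrite ler_nat ltnW// ltnS.
    by rewrite (leq_trans _ (s_ge k))// leq_maxr.
  rewrite ler_pdivrMr// => xm.
  rewrite c2 -[leLHS]mul1r ler_pdivrMr ?mulr_gt0//.
  have : x m * (c0 * c n ^+ 2 * V 1) <= x m * (c0 * c n ^+ 2 * V (x m)).
    by rewrite ler_pM2l// ler_pM2l.
  lra.
have Hbox p : box (x n) p -> c0 * c n ^+ 2 / 8 <=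
    Normc.normc (H k0 ((p.1 + x n) +i* p.2)) ^+ 2 +
    Normc.normc (H k ((p.1 + x n) +i* p.2)) ^+ 2.
  case: p => r y [/= + +]; rewrite !in_itv/= => /andP[r0 rx] /andP[y1 y2].
  set z := (r + x n) +i* y.
  have z0 : right_half_plane z by rewrite /right_half_plane /= ltr_wpDl.
  have F1 : c0 * c n ^+ 2 <= Normc.normc (F n (phi z)) ^+ 2.
    rewrite sqnormc_zen_test//; last exact: mphi.
    rewrite mulrC ler_pM2l// lerXn2r ?nnegrE//; first exact: ltW.
      by rewrite divr_ge0 ?addr_ge0 ?sqr_ge0.
    have := hC (r + x n) y _ _; rewrite -/z => hz.
    have {}hz : Normc.normc (phi z) <= C * (r + x n).
      apply: hz; last by rewrite ler_norml; lra.
      by rewrite ler_wpDl// ler1n.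
    have h2 := le_normcD (phi z) (x n)%:C.
    rewrite normcR gtr0_norm// in h2.
    have -> : (complex.Re (phi z) + x n) ^+ 2 + complex.Im (phi z) ^+ 2 =
        Normc.normc (phi z + (x n)%:C) ^+ 2.
      by rewrite sqr_normc; case: (phi z) => a b /=; rewrite addr0.
    have h3 : Normc.normc (phi z + (x n)%:C) <= (2 * C + 1) * x n.
      apply: (le_trans h2); have := x0 n; nra.
    have h4 : 0 < Normc.normc (phi z + (x n)%:C).
      rewrite normc_gt0 eq_complex negb_and gt_eqF//=.
      by have := mphi _ z0; rewrite /right_half_plane; case: (phi z) => a b /= a0; rewrite addr_gt0.
    rewrite /q ler_pdivlMr ?exprn_gt0// mulrC ler_pdivrMr; last first.
      by rewrite exprn_gt0// addr_gt0// mulr_gt0.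
    rewrite -exprMn ler_sqr ?nnegrE ?(ltW h4)// 1?mulrC//.
    by rewrite mulr_ge0// ltW// addr_gt0// mulr_gt0.
  have F2 : Normc.normc (F m (phi z)) ^+ 2 <= c m ^+ 2.
    by apply: zen_test_le => //; exact: mphi.
  (* The limit [G] cancels. Squaring twice gives [c0 * c n ^+ 2] at most four times the sum in the
     goal plus [2 * c m ^+ 2], and [cm] absorbs the latter. *)
  have e1 : F n (phi z) = (H k0 z - H k z) + F m (phi z).
    rewrite /H /composition -[(_ - G) z]/(F n (phi z) - G z) -[(_ - G) z]/(F m (phi z) - G z); ring.
  have := sqr_normcD (H k0 z - H k z) (F m (phi z)); rewrite -e1.
  have := sqr_normcD (H k0 z) (- H k z); rewrite normcN.
  lra.
have : ((c0 / 4)%:E <= zen_sqnorm nu (H k0) + zen_sqnorm nu (H k))%E.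
  apply: (le_trans _ (leeD (Hlow k0 _ (x0 n)) (Hlow k _ (x0 n)))).
  have mB := measurable_box (x n).
  have mH j : measurable_fun (box (x n))
      (fun p => (Normc.normc (H j ((p.1 + x n) +i* p.2)) ^+ 2)%:E).
    apply/measurable_EFinP; apply: measurable_funS (@sub_box_quadrant _ _) _.
      exact: measurable_quadrant.
    exact: (measurable_sqnormc (Hhol j) (x0 n)).
  rewrite -ge0_integralD//; last 2 first.
  - by move=> p _; rewrite lee_fin sqr_ge0.
  - by move=> p _; rewrite lee_fin sqr_ge0.
  (* The box has measure [2 / c n ^+ 2], so this integral equals [c0 / 4] whatever [n] is. *)
  apply: (@le_trans _ _ (\int[(nu \x @lebesgue_measure R)%E]_(p in box (x n)) (c0 * c n ^+ 2 / 8)%:E)%E).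
    rewrite integral_cst// [X in (_ * X)%E](product_measure_box nu_zen (x0 n)) -EFinM lee_fin -/V.
    rewrite c2 le_eqVlt; apply/orP; left; apply/eqP; field.
    by rewrite !gt_eqF.
  apply: ge0_le_integral => //.
  - by move=> p _; rewrite lee_fin divr_ge0// ltW.
  - exact: emeasurable_funD.
rewrite leNgt => /negP; apply.
have := lteD (hk0 _ (leqnn _)) (hk0 _ (leq_maxl _ k1)).
by rewrite -EFinD (_ : c0 / 8 + c0 / 8 = c0 / 4)//; field.
Qed.
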